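(* Suppose that $0<a_k<\infty$ and $0<b_k<\infty$ for all $k\in\mathbb{N}$, that $\sum_{k\in\mathbb{N}}(1/a_k)=\infty$, that $\mathcal{V}\ne\emptyset$, that $\sum_{k\in\mathbb{Z}_+}\alpha_k<\infty$, and that $X(0)\in\mathbb{X}_{\mathrm F}$. Then, for all $m_1,m_2,\ldots\in\mathbb{Z}_+$, $$\lim_{t\to\infty}\mathbb{P}\Big[\bigcap_{k\in\mathbb{N}}\{\eta_k(t)=m_k\}\Big]=\prod_{k\in\mathbb{N}}(1-\alpha_k)\alpha_k^{m_k}.$$
   Context: $\mathbb{N}=\{1,2,\dots\}$, $\mathbb{Z}_+=\{0,1,2,\dots\}$. Particle system: $\mathbb{X}=\{(x_1,x_2,\dots)\in\mathbb{Z}^{\mathbb{N}}:x_1<x_2<\cdots\}$ and $\mathbb{X}_{\mathrm F}=\{x\in\mathbb{X}:x_{k+1}-x_k=1\text{ for all but finitely many }k\}$. $X(t)=(X_1(t),X_2(t),\dots)$ is the continuous-time Markov chain in which the $k$th particle from the left, at location $X_k(t)$, attempts to jump one step left at rate $a_k$ and one step right at rate $b_k$, an attempted jump being suppressed if the destination site is occupied. Under $\sum_k 1/a_k=\infty$ and $X(0)\in\mathbb{X}_{\mathrm F}$, this is a well-defined non-explosive Markov chain on the countable set $\mathbb{X}_{\mathrm F}$. The numbers of holes are $\eta_k(t)=X_{k+1}(t)-X_k(t)-1$, $k\in\mathbb{N}$. Definitions: $\alpha_0=1$, $\beta_0=0$, and for $k\in\mathbb{N}$, $\alpha_k=\frac{a_1\cdots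 a_k}{b_1\cdots b_k}$, $\beta_k=\frac1{b_k}+\frac{a_k}{b_kb_{k-1}}+\cdots+\frac{a_k\cdots a_2}{b_k\cdots b_1}$. $\mathcal{V}$ is the set of $v\in\mathbb{R}$ such that $\alpha_k+v\beta_k\in(0,1)$ for all $k\in\mathbb{N}$. *)

(* Defs.v *)
From HB Require Import structures.
From mathcomp Require Import all_boot all_order all_algebra.
From mathcomp Require Import all_classical all_reals all_analysis.

Set Implicit Arguments.
Unset Strict Implicit.
Unset Printing Implicit Defensive.

Import Order.TTheory GRing.Theory Num.Theory.
Import numFieldNormedType.Exports.

Local Open Scope classical_set_scope.
Local Open Scope ring_scope.

(* Sequences indexed by {1, 2, ...} are functions on nat shifted by one: x k,  *)
(* a k, b k, holes x k stand for x_{k+1}, a_{k+1}, b_{k+1}, eta_{k+1}.         *)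
(* alpha and beta, which are indexed from 0, are not shifted.                  *)

Definition config : set (nat -> int) := [set x | forall k, x k < x k.+1].

Definition configF : set (nat -> int) :=
  [set x | config x /\ finite_set [set k | x k.+1 - x k != 1]].

Definition holes (x : nat -> int) (k : nat) : int := x k.+1 - x k - 1.

Definition jumps (x : nat -> int) (k : nat) (d : int) (y : nat -> int) : Prop :=
  (forall j, x j != x k + d) /\ y = (fun j => if j == k then x k + d else x j).

(* At most one particle and direction contribute when x is strictly            *)
(* increasing, so the sums are finite.                                         *)
Definition jump_rate (R : realType) (a b : nat -> R) (x y : nat -> int)
  : \bar R :=
  (\esum_(k in [set k | jumps x k (-1) y]) (a k)%:E +
   \esum_(k in [set k | jumps x k 1 y]) (b k)%:E)%E.

Definition alpha (R : realType) (a b : nat -> R) (k : nat) : R :=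
  (\prod_(i < k) a i) / (\prod_(i < k) b i).

(* The j-th summand is (a_k ... a_{j+2}) / (b_k ... b_{j+1}) in 1-based        *)
(* indices.                                                                    *)
Definition beta (R : realType) (a b : nat -> R) (k : nat) : R :=
  \sum_(j < k) (\prod_(j.+1 <= i < k) a i) / (\prod_(j <= i < k) b i).

Definition calV (R : realType) (a b : nat -> R) : set R :=
  [set v | forall k, 0 < alpha a b k.+1 + v * beta a b k.+1 < 1].

(* Honest (mass-one) transition function on S whose derivative at 0 is the     *)
(* conservative Q-matrix with off-diagonal entries q; the total mass one is    *)
(* what makes a chain with this transition function live on S for all times.   *)
(* Only the values p t with t >= 0 matter.                                     *)
Record transition_function (R : realType) (S : choiceType)
    (q : S -> S -> \bar R) (p : R -> S -> S -> R) : Prop := TransitionFunction {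
  tf_ge0 : forall (t : R) x y, 0 <= t -> 0 <= p t x y ;
  tf_mass : forall (t : R) x, 0 <= t -> (\esum_(y in [set: S]) (p t x y)%:E = 1)%E ;
  tf_0 : forall x y, p 0 x y = (x == y)%:R ;
  tf_chapman_kolmogorov : forall (s t : R) x y, 0 <= s -> 0 <= t ->
    ((p (s + t) x y)%:E = \esum_(z in [set: S]) (p s x z * p t z y)%:E)%E ;
  tf_rate : forall x y, x != y -> (p h x y / h)%:E @[h --> 0^'+] --> q x y ;
  tf_exit_rate : forall x, ((1 - p h x x) / h)%:E @[h --> 0^'+] -->
    \esum_(y in [set y | y != x]) q x y
}.

(* Continuous-time Markov chain (X t), t >= 0, with arbitrary initial law.     *)
Definition markov_chain (R : realType) (S : choiceType) (q : S -> S -> \bar R)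
    (d : measure_display) (T : measurableType d) (P : probability T R)
    (X : R -> T -> S) : Prop :=
  (forall (t : R) x, 0 <= t -> measurable [set w | X t w = x]) /\
  exists2 p : R -> S -> S -> R, transition_function q p &
    forall (n : nat) (t : nat -> R) (x : nat -> S),
      0 <= t 0%N -> (forall i, t i <= t i.+1) ->
      (P [set w | forall i, (i <= n.+1)%N -> X (t i) w = x i] =
       P [set w | forall i, (i <= n)%N -> X (t i) w = x i] *
       (p (t n.+1 - t n) (x n) (x n.+1))%:E)%E.

(* Main.v *)
Require Import Defs.
From HB Require Import structures.
From mathcomp Require Import all_boot all_order all_algebra.
From mathcomp Require Import finmap.
From mathcomp Require Import all_classical all_reals all_analysis.
From mathcomp Require Import zify ring lra.

Set Implicit Arguments.
Unset Strict Implicit.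
Unset Printing Implicit Defensive.

Import Order.TTheory GRing.Theory Num.Theory.
Import numFieldNormedType.Exports.

Local Open Scope classical_set_scope.
Local Open Scope ring_scope.

(** The holes of the particle system form a chain of queues: a hole crosses particle
    [k] to the right at rate [a k] and to the left at rate [b k]. Each hole in
    the gap after particle [k] contributes a factor [alpha k.+1] to the [weight]
    of a configuration, and the weight satisfies detailed balance with the rates
    ([weight_rev]). The hypotheses give [alpha k.+1 < 1] ([alpha_lt1]); as the
    [alpha k] are summable, the total weight of the gap sequences with finitely
    many holes is the inverse of the infinite product of the [1 - alpha k.+1]
    ([esum_weight]). The limit law is the normalized weight.

    The transition function is given only through its derivative at time 0, so
    that it has to be tied to the rates first. Every probability [hit B t x]
    satisfies the backward equation ([hit_dini_ge], [hit_dini_le]), and bounded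
    subsolutions of this equation obey a maximum principle, because the chain
    cannot explode: the function [depth], the sum of [(a k)^-1] over the
    particles up to the last hole, grows at rate at most 1 in mean, and the jump rates
    are bounded where it is bounded ([maximum_principle], [depth_gen],
    [depth_rate]). The maximum principle is used twice. It shows that the kernel
    commutes with translations ([lumped_shiftl]), so that the gap sequences have a
    transition kernel [lumped] of their own; and it shows that this kernel is
    reversible for the weight ([detailed_balance]), since the kernel with its
    arguments exchanged is a supersolution of the backward equation, by the
    forward inequality [lumped_forward].

    For a reversible kernel [k] with finite measure [mu] convergence is
    elementary. The Dirichlet form of [k t _ m] equals, up to the factor
    [2 * mu m], the drop of the return probability of [m] between the times [2 t]
    and [2 t + s] ([dirichlet_form_bound]). Hence return probabilities decrease,
    the drop tends to 0, and [k t x m] becomes independent of [x], the states being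
    connected by moves ([lumped_diff]). By invariance of [mu] its limit is [mu m]
    divided by the total mass ([reversible_kernel_cvg]). Averaging over the initial
    law ends the proof when the prescribed gap sequence has finitely many nonzero
    entries; otherwise both sides vanish. *)

(** * Maximum principle for a generator with a Lyapunov function *)

(** The upper right Dini derivative of [f] at [t] is at most [c]. Working with
    one-sided inequalities avoids differentiability altogether: a transition
    function is only known through its right derivative at 0. *)
Definition dini_le (R : realType) (f : R -> R) (t c : R) : Prop :=
  forall e, 0 < e -> \forall h \near 0^'+, f (t + h) <= f t + (c + e) * h.

(** Continuity along [t >= 0], the only times at which a transition function is
    constrained. *)
Definition cont_nneg (R : realType) (f : R -> R) : Prop :=
  forall t : R, 0 <= t -> f @ within [set s : R | 0 <= s] (nbhs t) --> f t.

Lemma cont_nnegP (R : realType) (f : R -> R) : cont_nneg f <->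
  forall t, 0 <= t -> forall e, 0 < e -> exists2 d, 0 < d &
    forall s, 0 <= s -> `|s - t| < d -> `|f s - f t| < e.
Proof.
split=> fc t t0.
  move=> e e0; have /cvgrPdist_lt /(_ e e0) := fc t t0.
  rewrite near_withinE => /nbhs_ballP[d /= d0 bd]; exists d => // s s0 st.
  by rewrite distrC; apply: (bd s) => //; rewrite /ball/= distrC.
apply/cvgrPdist_lt => e e0; have [d d0 fd] := fc t t0 e e0.
rewrite near_withinE; apply/nbhs_ballP; exists d => //= s st s0.
by rewrite distrC; apply: fd => //; rewrite distrC.
Qed.

Lemma near0_lt (R : realType) (P : R -> Prop) (d : R) : 0 < d ->
  (\forall h \near 0^'+, P h) -> exists2 h, 0 < h < d & P h.
Proof.
move=> d0 Ph.
have : \forall h \near (0:R)^'+, (0 < h < d) /\ P h.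
  near=> h; split; last by near: h.
  apply/andP; split; near: h; first exact: nbhs_right_gt.
  exact: nbhs_right_lt.
by move=> /filter_ex[h []]; exists h.
Unshelve. all: by end_near. Qed.

(** If [f] ended above a line of slope [c + e], it would leave that line for the
    last time at some [s], where [f s] is nonnegative and the growth rate of [f]
    exceeds [c]. The rate is bounded only where [f] is nonnegative, which is all
    that the maximum principle can provide. *)
Lemma dini_growth (R : realType) (f : R -> R) (c t0 t1 : R) :
  0 <= t0 -> 0 <= c -> cont_nneg f -> f t0 <= 0 ->
  (forall t, t0 <= t < t1 -> 0 <= f t -> dini_le f t c) ->
  forall t, t0 <= t <= t1 -> f t <= c * (t - t0).
Proof.
move=> t00 c0 /cont_nnegP fc ft0 fdini t /andP[t0t tt1]; rewrite leNgt; apply/negP => ft.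
have t0t' : t0 < t.
  rewrite lt_neqAle t0t andbT; apply/eqP => E; move: ft; rewrite -E; lra.
pose e := (f t - c * (t - t0)) / (2 * (t - t0)).
have e0 : 0 < e by rewrite /e divr_gt0//; lra.
have fte : (c + e) * (t - t0) < f t.
  rewrite mulrDl (_ : e * (t - t0) = (f t - c * (t - t0)) / 2); first lra.
  by rewrite /e; field; lra.
pose A : set R := [set s | t0 <= s <= t /\ f s <= (c + e) * (s - t0)].
have At0 : A t0 by split; [lra|rewrite subrr mulr0].
have Aub : has_sup A by split; [exists t0|exists t => s [/andP[]]].
pose s := sup A.
have ts : t0 <= s by apply: (ub_le_sup Aub.2).
have st : s <= t by apply: sup_le_ub => [|u [/andP[]//]]; exists t0.
have s0 : 0 <= s by lra.
have above u : s < u <= t -> (c + e) * (u - t0) < f u.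
  move=> /andP[su ut]; rewrite ltNge; apply/negP => fu.
  have : u <= s by apply: (ub_le_sup Aub.2); split => //; lra.
  lra.
have gs_le : f s <= (c + e) * (s - t0).
  rewrite leNgt; apply/negP => fs.
  have [d d0 fd] := fc s s0 (f s - (c + e) * (s - t0)) ltac:(lra).
  have [u [/andP[u0 ut] fu] us] := sup_adherent d0 Aub.
  have us' : u <= s by apply: (ub_le_sup Aub.2); split => //; rewrite u0.
  have := fd u ltac:(lra).
  rewrite !ltr_norml => /(_ ltac:(rewrite -/s in us; lra)) /andP[fsu _].
  have : (c + e) * (u - t0) <= (c + e) * (s - t0) by apply: ler_wpM2l; lra.
  lra.
have slt : s < t.
  rewrite lt_neqAle st andbT; apply/eqP => E; move: gs_le; rewrite E; lra.
have fs0 : 0 <= f s.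
  rewrite leNgt; apply/negP => fs.
  have [d d0 fd] := fc s s0 (- f s) ltac:(lra).
  pose u := Num.min (s + d / 2) t.
  have su : s < u <= t by rewrite /u lt_min ge_min lexx orbT; lra.
  have ud : u <= s + d / 2 by rewrite /u ge_min lexx.
  have := fd u ltac:(lra); rewrite !ltr_norml => /(_ ltac:(lra)) /andP[_ fu].
  have := above u su.
  have : 0 <= (c + e) * (u - t0) by apply: mulr_ge0; lra.
  lra.
have [h /andP[h0 hd] fh] := near0_lt (d:=t - s) ltac:(lra) (fdini s ltac:(lra) fs0 e e0).
have := above (s + h) ltac:(lra).
have : (c + e) * (s + h - t0) = (c + e) * (s - t0) + (c + e) * h by ring.
lra.
Qed.

(** The operator [f |-> Q f] of a jump process: a suppressed move [mv x i = x]
    contributes nothing, so no indicator of admissibility is needed. *)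
Definition generator (R : realType) (S I : Type) (dom : S -> seq I) (rt : I -> R)
    (mv : S -> I -> S) (f : S -> R) (x : S) : R :=
  \sum_(i <- dom x) rt i * (f (mv x i) - f x).

Lemma cont_nnegB (R : realType) (f g : R -> R) :
  cont_nneg f -> cont_nneg g -> cont_nneg (fun t => f t - g t).
Proof. by move=> fc gc t t0; apply: cvgB; [exact: fc|exact: gc]. Qed.

Lemma cont_nneg_affine (R : realType) (a b : R) : cont_nneg (fun t => a * (b + t)).
Proof.
move=> t _; apply: cvg_within_filter.
by apply: cvgM; [exact: cvg_cst|apply: cvgD; [exact: cvg_cst|exact: cvg_id]].
Qed.

(** Subtracting [e * (V x + t)] from a subsolution [w] gives [phi], which is still
    a subsolution because the generator maps [V] below 1. Where [phi] is
    nonnegative, [V] is at most [K / e], hence the total rate is at most some [C]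
    and [phi] grows at rate at most [C * sup phi]. Over a time [d = 1 / (2 C)]
    any upper bound of [phi] is therefore halved, so [phi <= 0]; the same [d]
    works on every later time interval. The sublevel sets of [V] may be
    infinite, hence the hypothesis on the rates in them. *)
Theorem maximum_principle (R : realType) (S I : Type) (dom : S -> seq I)
    (rt : I -> R) (mv : S -> I -> S) (V : S -> R) (w : R -> S -> R) (K : R) :
  (forall i, 0 <= rt i) -> (forall x, 0 <= V x) ->
  (forall x, generator dom rt mv V x <= 1) ->
  (forall L, exists C, forall x, V x <= L -> \sum_(i <- dom x) rt i <= C) ->
  (forall t x, 0 <= t -> w t x <= K) ->
  (forall x, w 0 x <= 0) ->
  (forall x, cont_nneg (w ^~ x)) ->
  (forall t x, 0 <= t -> dini_le (w ^~ x) t (generator dom rt mv (w t) x)) ->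
  forall t x, 0 <= t -> w t x <= 0.
Proof.
move=> rt0 V0 genV Vrate wK w0 wc wdini.
(* [e = w t x / (V x + t + 1)] makes the subtracted term smaller than [w t x] *)
suff phi_le e : 0 < e -> forall t x, 0 <= t -> w t x - e * (V x + t) <= 0.
  move=> t x t0; rewrite leNgt; apply/negP => wt.
  have Vt : 0 < V x + t + 1 by have := V0 x; lra.
  have := phi_le (w t x / (V x + t + 1)) (divr_gt0 wt Vt) t x t0.
  apply/negP; rewrite -ltNge subr_gt0 -mulrA gtr_pMr// mulrC ltr_pdivrMr//; lra.
move=> e0; have [C0 C0P] := Vrate (K / e).
pose C := `|C0| + 1; have Cge : C0 <= C by rewrite /C; have := ler_norm C0; lra.
have C_gt0 : 0 < C by rewrite /C; have := normr_ge0 C0; lra.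
pose phi t x := w t x - e * (V x + t).
have phi_dini M t x : 0 <= t -> 0 <= M -> (forall y, phi t y <= M) ->
    0 <= phi t x -> dini_le (phi ^~ x) t (C * M).
  move=> t0 M0 phiM phi0 r r0.
  have Vx : V x <= K / e.
    rewrite ler_pdivlMr//; have := wK t x t0; move: phi0; rewrite /phi.
    have := mulr_ge0 (ltW e0) t0; lra.
  have genphi : generator dom rt mv (phi t) x <= C * M.
    apply: (@le_trans _ _ (\sum_(i <- dom x) rt i * M)).
      apply: ler_sum => i _; apply: ler_wpM2l => //.
      by have := phiM (mv x i); lra.
    by rewrite -mulr_suml; apply: ler_wpM2r => //; have := C0P x Vx; lra.
  have genw : generator dom rt mv (w t) x <= C * M + e.
    have -> : generator dom rt mv (w t) x =
        generator dom rt mv (phi t) x + e * generator dom rt mv V x.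
      rewrite /generator mulr_sumr -big_split/=; apply: eq_bigr => i _.
      by rewrite /phi; ring.
    have := ler_wpM2l (ltW e0) (genV x); lra.
  have := wdini t x t0 r r0; apply: filterS2 (nbhs_right_gt (0:R)) => h h0 wh.
  rewrite /phi; have : (generator dom rt mv (w t) x + r) * h <= (C * M + e + r) * h.
    by apply: ler_wpM2r; lra.
  lra.
have phi_cont x : cont_nneg (phi ^~ x).
  by apply: cont_nnegB => //; exact: cont_nneg_affine.
pose d := (2 * C)^-1.
have d0 : 0 < d by rewrite invr_gt0; lra.
have Cd : C * d = 2^-1 by rewrite /d; field; lra.
(* [d] does not depend on the starting time, which allows an induction over time *)
have step t0 : 0 <= t0 -> (forall x, phi t0 x <= 0) ->
    forall t x, t0 <= t <= t0 + d -> phi t x <= 0.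
  move=> t00 phit0.
  have halves j : forall t x, t0 <= t <= t0 + d -> phi t x <= `|K| / 2 ^+ j.
    elim: j => [|j IH] t x tt.
      rewrite expr0 divr1 /phi; have := wK t x ltac:(lra); have := ler_norm K.
      by have := mulr_ge0 (ltW e0) (addr_ge0 (V0 x) (le_trans t00 (andP tt).1)); lra.
    have M0 : 0 <= `|K| / 2 ^+ j by rewrite divr_ge0// exprn_ge0.
    have := @dini_growth R (phi ^~ x) (C * (`|K| / 2 ^+ j)) t0 (t0 + d) t00
      (mulr_ge0 (ltW C_gt0) M0) (phi_cont x) (phit0 x) _ t tt.
    move=> /(_ _)/wrap[].
      move=> s ss phis; apply: phi_dini => //; first lra.
      by move=> y; apply: IH; lra.
    move=> /le_trans; apply.
    apply: (@le_trans _ _ (C * (`|K| / 2 ^+ j) * d)).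
      by apply: ler_wpM2l; [rewrite mulr_ge0//; lra|lra].
    rewrite mulrAC Cd exprS invfM; lra.
  move=> t x tt; rewrite leNgt; apply/negP => phi_pos.
  have K0 : 0 < `|K| + 1 by have := normr_ge0 K; lra.
  have /cvgrPdist_lt := @cvg_geometric R (`|K|+1) 2^-1 ltac:(rewrite ger0_norm; lra).
  move=> /(_ _ phi_pos) [j _ /(_ j (leqnn j))].
  rewrite /geometric/= sub0r normrN ger0_norm; last first.
    by rewrite mulr_ge0 ?exprn_ge0//; lra.
  have := halves j t x tt; rewrite exprVn.
  have : `|K| / 2 ^+ j <= (`|K| + 1) / 2 ^+ j by apply: ler_wpM2r; [rewrite invr_ge0 exprn_ge0|lra].
  lra.
have all_n n : forall t x, 0 <= t <= n%:R * d -> phi t x <= 0.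
  elim: n => [|n IH] t x tt.
    have -> : t = 0 by lra.
    by rewrite /phi addr0; have := w0 x; have := mulr_ge0 (ltW e0) (V0 x); lra.
  have [tn|tn] := leP t (n%:R * d); first by apply: IH; lra.
  have nd : 0 <= n%:R * d by rewrite mulr_ge0//; lra.
  apply: (step (n%:R * d)) => //; first by move=> y; apply: IH; lra.
  by move: tt; rewrite -natr1; lra.
move=> t x t0; apply: (all_n (Num.bound (t / d))).
rewrite t0/= -ler_pdivrMr//; apply/ltW/archi_boundP.
by rewrite divr_ge0//; lra.
Qed.

(** * Sums of nonnegative families over a set *)

Section EsumComplements.
Variables (R : realType) (T : choiceType).
Implicit Types (A B : set T) (a b : T -> \bar R).
Local Open Scope ereal_scope.

Lemma le_esum_set A B a : (forall x, B x -> 0 <= a x) -> A `<=` B ->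
  \esum_(x in A) a x <= \esum_(x in B) a x.
Proof.
move=> a0 AB; rewrite [leRHS](esumID A)// (_ : B `&` A = A); last exact/setIidPr.
by rewrite leeDl// esum_ge0// => x [] /a0.
Qed.

Lemma esumZl A a (c : R) : (0 <= c)%R -> (forall x, A x -> 0 <= a x) ->
  \esum_(x in A) (c%:E * a x) = c%:E * \esum_(x in A) a x.
Proof.
rewrite le_eqVlt => /predU1P[<- a0|c0 a0].
  by rewrite mul0e esum1// => x _; rewrite mul0e.
have le_mul (d : R) b : (0 < d)%R -> (forall x, A x -> 0 <= b x) ->
    \esum_(x in A) (d%:E * b x) <= d%:E * \esum_(x in A) b x.
  move=> d0 b0; apply: ge_ereal_sup => _ [X [finX XA] <-].
  rewrite fsbig_finite//= big_seq.
  rewrite -ge0_sume_distrr; last first.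
    by move=> x; rewrite in_fset_set// inE => /XA; exact: b0.
  rewrite lee_pmul2l// esum_ge//; exists X => //.
  by rewrite fsbig_finite//= [leRHS]big_seq.
apply/eqP; rewrite eq_le le_mul//=.
have -> : \esum_(x in A) a x = \esum_(x in A) (c^-1%:E * (c%:E * a x)).
  by apply: eq_esum => x _; rewrite muleA -EFinM mulVf ?gt_eqF// mul1e.
rewrite (le_trans (lee_wpmul2l _ (le_mul c^-1%R _ _ _)))//.
- by rewrite lee_fin ltW.
- by rewrite invr_gt0.
- by move=> x Ax; rewrite mule_ge0 ?a0// lee_fin ltW.
- by rewrite muleA -EFinM mulfV ?gt_eqF// mul1e.
Qed.

Lemma le_sum_esum A a (r : seq T) : uniq r -> (forall x, x \in r -> A x) ->
  (forall x, A x -> 0 <= a x) ->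
  \sum_(x <- r) a x <= \esum_(x in A) a x.
Proof.
move=> ur rA a0; by rewrite fsbig_seq// esum_ge//; exists [set` r].
Qed.

Lemma ge_esum_term A a y : (forall x, A x -> 0 <= a x) -> A y ->
  a y <= \esum_(x in A) a x.
Proof.
move=> a0 Ay; have := @le_sum_esum A a [:: y] isT.
by rewrite big_seq1; apply => // x; rewrite inE => /eqP->.
Qed.

Lemma exchange_esum (U : choiceType) A (B : set U) (f : T -> U -> \bar R) :
  (forall x y, A x -> B y -> 0 <= f x y) ->
  \esum_(x in A) \esum_(y in B) f x y = \esum_(y in B) \esum_(x in A) f x y.
Proof.
move=> f0; rewrite esum_esum// esum_esum; last by move=> y x By Ax; exact: f0.
apply: (@reindex_esum R _ _ (B `*`` (fun=> A)) (A `*`` (fun=> B))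
  (fun z : U * T => (z.2, z.1)) (fun z => f z.1 z.2)); split.
- by move=> [y x] [].
- by move=> [y x] [y' x'] _ _ [-> ->].
- by move=> [x y] [/= Ax By]; exists (y, x).
Qed.

Lemma ge0_esum_fin A (f : T -> R) :
  (forall x, A x -> (0 <= f x)%R) -> \esum_(x in A) (f x)%:E < +oo ->
  (fine (\esum_(x in A) (f x)%:E))%:E = \esum_(x in A) (f x)%:E.
Proof.
by move=> f0 foo; rewrite fineK// ge0_fin_numE//; apply: esum_ge0.
Qed.

Lemma esum_dist A (mu f g : T -> R) (r s e : R) :
  (forall x, A x -> (0 <= mu x)%R) ->
  (forall x, A x -> (0 <= f x)%R) -> (forall x, A x -> (0 <= g x)%R) ->
  \esum_(x in A) (mu x * f x)%:E = r%:E ->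
  \esum_(x in A) (mu x * g x)%:E = s%:E ->
  \esum_(x in A) (mu x * `|f x - g x|)%:E = e%:E -> (`|r - s| <= e)%R.
Proof.
move=> mu0.
have le (f' g' : T -> R) (r' s' : R) : (forall x, A x -> (0 <= g' x)%R) ->
    \esum_(x in A) (mu x * f' x)%:E = r'%:E ->
    \esum_(x in A) (mu x * g' x)%:E = s'%:E ->
    \esum_(x in A) (mu x * `|f' x - g' x|)%:E = e%:E -> (r' <= e + s')%R.
  move=> g0 fr gs dist; rewrite -lee_fin EFinD -fr -gs -dist -esumD.
  - apply: le_esum => x Ax; rewrite -EFinD lee_fin -mulrDr ler_wpM2l ?mu0//.
    by have := ler_norm (f' x - g' x); lra.
  - by move=> x Ax; rewrite lee_fin mulr_ge0 ?mu0.
  - by move=> x Ax; rewrite lee_fin mulr_ge0 ?mu0 ?g0.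
move=> f0 g0 fr gs dist; rewrite ler_norml; apply/andP; split.
  have := le g f s r f0 gs fr; rewrite -dist => /(_ _)/wrap[]; last by lra.
  by apply: eq_esum => x _; rewrite distrC.
by have := le f g r s g0 fr gs dist; lra.
Qed.

End EsumComplements.

(** Dominated convergence: outside a finite set the weight [mu] has total mass
    below [e / 2], and on that finite set the sum tends to 0 term by term. *)
Lemma esum_cvg0 (R : realType) (T : choiceType) (A : set T) (mu : T -> R)
    (F : set_system R) {FF : Filter F} (f : R -> T -> R) :
  (forall x, A x -> 0 <= mu x) -> (\esum_(x in A) (mu x)%:E < +oo)%E ->
  (\forall t \near F, forall x, A x -> 0 <= f t x <= 1) ->
  (forall x, A x -> f t x @[t --> F] --> (0 : R)) ->
  (\esum_(x in A) (mu x * f t x)%:E)%E @[t --> F] --> (0%:E : \bar R).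
Proof.
move=> mu0 muoo f01 fx.
have mu0' x : A x -> (0 <= (mu x)%:E)%E by move=> Ax; rewrite lee_fin mu0.
apply/fine_cvgP; split.
  near=> t; rewrite ge0_fin_numE; last first.
    apply: esum_ge0 => x Ax; rewrite lee_fin mulr_ge0 ?mu0//.
    by have /andP[] : 0 <= f t x <= 1 by move: x Ax; near: t.
  apply: le_lt_trans muoo; apply: le_esum => x Ax; rewrite lee_fin ler_piMr ?mu0//.
  by have /andP[] : 0 <= f t x <= 1 by move: x Ax; near: t.
apply/cvgrPdist_lt => e e0.
pose Z := fine (\esum_(x in A) (mu x)%:E)%E.
have ZE : Z%:E = (\esum_(x in A) (mu x)%:E)%E by exact: ge0_esum_fin.
have [_ [X [finX XA] <-] Xe] : exists2 y : \bar R,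
    [set (\sum_(x \in X) (mu x)%:E)%E | X in fsets A] y & ((Z - e / 2)%:E < y)%E.
  by apply: ereal_sup_gt; rewrite -[X in (_ < X)%E]/(esum A _) -ZE lte_fin; lra.
pose r : seq T := fset_set X.
have rX x : (x \in r) = (x \in X) by rewrite in_fset_set.
have rA x : x \in r -> A x by rewrite rX inE => /XA.
have AX : A `&` X = X by apply/setIidPr.
have tail : (\esum_(x in A `&` ~` X) (mu x)%:E <= (e / 2)%:E)%E.
  have : ((Z - e/2)%:E + \esum_(x in A `&` ~` X) (mu x)%:E <= Z%:E)%E.
    rewrite ZE [leRHS](esumID X)// AX leeD2r// (le_trans (ltW Xe))//.
    by apply: esum_ge; exists X => //; exact: fsets_self.
  rewrite -leeBrDl//= => /le_trans; apply; rewrite -EFinB lee_fin; lra.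
have head : \forall t \near F, \sum_(x <- r) mu x * f t x < e / 2.
  have : \sum_(x <- r) mu x * f t x @[t --> F] --> (0 : R).
    elim: (r) rA => [_|x s IH sA].
      by under eq_fun do rewrite big_nil; exact: cvg_cst.
    under eq_fun do rewrite big_cons.
    suff : mu x * f t x + \sum_(y <- s) mu y * f t y @[t --> F] --> (mu x * 0 + 0 : R).
      by rewrite mulr0 addr0.
    apply: cvgD; last by apply: IH => y ys; apply: sA; rewrite inE ys orbT.
    by apply: cvgM; [exact: cvg_cst|apply: fx; apply: sA; rewrite mem_head].
  by move=> h; apply: (cvgr_lt 0 h); rewrite divr_gt0.
near=> t; rewrite sub0r normrN.
have ft x : A x -> 0 <= f t x <= 1 by move: x; near: t.
have muf0 x : A x -> (0 <= (mu x * f t x)%:E)%E.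
  by move=> Ax; rewrite lee_fin mulr_ge0 ?mu0//; case/andP: (ft x Ax).
have s0 : (0 <= \esum_(x in A) (mu x * f t x)%:E)%E by apply: esum_ge0.
rewrite /= ger0_norm ?fine_ge0// -lte_fin fineK; last first.
  rewrite ge0_fin_numE//; apply: le_lt_trans muoo; apply: le_esum => x Ax.
  by rewrite lee_fin ler_piMr ?mu0//; case/andP: (ft x Ax).
rewrite (esumID X)// AX esum_fset//; last by move=> x; rewrite inE => /XA; exact: muf0.
rewrite (_ : e%:E = (e/2)%:E + (e/2)%:E)%E; last by rewrite -EFinD; congr EFin; lra.
have tail' : (\esum_(x in A `&` ~` X) (mu x * f t x)%:E <= (e / 2)%:E)%E.
  apply: le_trans tail; apply: le_esum => x [Ax _]; rewrite lee_fin ler_piMr ?mu0//.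
  by case/andP: (ft x Ax).
apply: lte_leD => //.
  rewrite ge0_fin_numE ?(le_lt_trans tail')// ?ltry//.
  by apply: esum_ge0 => x [Ax _]; exact: muf0.
by rewrite fsbig_finite//= sumEFin lte_fin; near: t.
Unshelve. all: by end_near. Qed.

(** * Transition functions and their generators *)

(** The lower right Dini derivative of [f] at [t] is at least [c]. *)
Definition dini_ge (R : realType) (f : R -> R) (t c : R) : Prop :=
  forall e, 0 < e -> \forall h \near 0^'+, f t + (c - e) * h <= f (t + h).

Lemma dini_leB (R : realType) (f g : R -> R) (t c d : R) :
  dini_le f t c -> dini_ge g t d -> dini_le (fun s => f s - g s) t (c - d).
Proof.
move=> fc gd e e0; have e20 : 0 < e / 2 by lra.
by apply: filterS2 (fc _ e20) (gd _ e20) => h fh gh /=; lra.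
Qed.

Lemma dini_geN (R : realType) (f : R -> R) (t c a : R) :
  dini_ge f t c -> dini_le (fun s => a - f s) t (- c).
Proof. by move=> fc e e0; apply: filterS (fc e e0) => h fh /=; lra. Qed.

Section Generator.
Variables (R : realType) (S I : Type) (dom : S -> seq I) (rt : I -> R)
  (mv : S -> I -> S).
Local Notation gen := (generator dom rt mv).

Lemma genB (f g : S -> R) x : gen (fun y => f y - g y) x = gen f x - gen g x.
Proof.
by rewrite /generator -sumrB; apply: eq_bigr => i _; ring.
Qed.

Lemma gen_cst (a : R) (f : S -> R) x : gen (fun y => a - f y) x = - gen f x.
Proof.
by rewrite /generator -sumrN; apply: eq_bigr => i _; ring.
Qed.

End Generator.

Lemma near_sum_le (R : realType) (I : eqType) (r : seq I) (P : pred I)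
    (c : I -> R) (f : I -> R -> R) (F : set_system R) : Filter F ->
  (forall i, i \in r -> P i -> \forall h \near F, c i * h <= f i h) ->
  \forall h \near F, \sum_(i <- r | P i) c i * h <= \sum_(i <- r | P i) f i h.
Proof.
move=> FF; elim: r => [|i r IH] cf.
  by apply: nearW => h; rewrite !big_nil.
have : \forall h \near F, P i -> c i * h <= f i h.
  case: (boolP (P i)) => [Pi|_]; last exact: nearW.
  by apply: filterS (cf i (mem_head _ _) Pi).
have := IH (fun j jr => cf j (mem_behead (s := i :: r) jr)).
apply: filterS2 => h sh ih; rewrite !big_cons; case: ifP => // Pi.
by apply: lerD => //; exact: ih.
Qed.

(** Common core of the backward and the forward inequality: a lower bound of
    [f (t + h)] by finitely many jumps of probability at least [rt i * h] and one
    holding term of probability at least [1 - h * (total rate)], up to [o(h)]. *)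
Lemma dini_ge_moves (R : realType) (S I : eqType) (dom : S -> seq I)
    (rt : I -> R) (mv : S -> I -> S) (U : S -> R) (x : S) (f : R -> R) (t : R)
    (jump : I -> R -> R) (stay : R -> R) :
  (forall y, 0 <= U y) -> f t = U x ->
  (\forall h \near 0^'+, \sum_(i <- dom x | mv x i != x) U (mv x i) * jump i h
     + U x * stay h <= f (t + h)) ->
  (forall i, i \in dom x -> mv x i != x ->
     forall e, 0 < e -> \forall h \near 0^'+, (rt i - e) * h <= jump i h) ->
  (forall e, 0 < e -> \forall h \near 0^'+,
     1 - stay h <= (\sum_(i <- dom x | mv x i != x) rt i + e) * h) ->
  dini_ge f t (generator dom rt mv U x).
Proof.
move=> U0 ft fge jump_ge stay_ge e e0.
(* the errors [d * h] of the jump and holding terms add up to at most [d * W * h] *)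
pose W := \sum_(i <- dom x | mv x i != x) U (mv x i) + U x + 1.
have W0 : 0 < W.
  rewrite /W; have := U0 x.
  have : 0 <= \sum_(i <- dom x | mv x i != x) U (mv x i) by apply: sumr_ge0.
  lra.
pose d := e / W; have d0 : 0 < d by rewrite divr_gt0.
have dW : d * W = e by rewrite /d divfK// gt_eqF.
have jumps : \forall h \near 0^'+,
    \sum_(i <- dom x | mv x i != x) (U (mv x i) * (rt i - d)) * h <=
    \sum_(i <- dom x | mv x i != x) U (mv x i) * jump i h.
  apply: near_sum_le => i ix im; apply: filterS (jump_ge i ix im d d0) => h hh.
  by rewrite -mulrA; apply: ler_wpM2l.
have pos := nbhs_right_gt (0 : R).
apply: filterS3 fge jumps (filterI pos (stay_ge d d0)) => h fh jh [h0 sh].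
apply: le_trans fh; rewrite ft.
have genE : generator dom rt mv U x = \sum_(i <- dom x | mv x i != x) U (mv x i) * rt i
    - U x * \sum_(i <- dom x | mv x i != x) rt i.
  rewrite /generator mulr_sumr -sumrB [RHS]big_mkcond/=; apply: eq_bigr => i _.
  by case: eqP => [->|_] /=; ring.
have jh' : \sum_(i <- dom x | mv x i != x) (U (mv x i) * (rt i - d)) * h =
    (\sum_(i <- dom x | mv x i != x) U (mv x i) * rt i
     - d * \sum_(i <- dom x | mv x i != x) U (mv x i)) * h.
  by rewrite -mulr_suml mulr_sumr -sumrB; congr (_ * _); apply: eq_bigr => i _; ring.
have uh : U x * (1 - (\sum_(i <- dom x | mv x i != x) rt i + d) * h) <= U x * stay h.
  by apply: ler_wpM2l => //; lra.
have eh : e * h = d * h * \sum_(i <- dom x | mv x i != x) U (mv x i) + d * h * U x + d * h.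
  by rewrite -dW /W; ring.
have dh : 0 < d * h by rewrite mulr_gt0.
move: jh uh; rewrite genE jh'; set A := \sum_(i <- _ | _) _ * rt i.
set B := \sum_(i <- dom x | mv x i != x) rt i.
set C := \sum_(i <- dom x | mv x i != x) U (mv x i) in eh *.
have -> : (A - d * C) * h = A * h - d * h * C by ring.
have -> : U x * (1 - (B + d) * h) = U x - U x * B * h - d * h * U x by ring.
have -> : (A - U x * B - e) * h = A * h - U x * B * h - e * h by ring.
lra.
Qed.

Section TransitionFunction.
Variables (R : realType) (S : choiceType) (q : S -> S -> \bar R)
  (p : R -> S -> S -> R).
Hypothesis tf : transition_function q p.
Local Open Scope ereal_scope.

Definition hit (B : set S) (t : R) (x : S) : R :=
  fine (\esum_(y in B) (p t x y)%:E).

Let p0 (t : R) x y : (0 <= t)%R -> 0 <= (p t x y)%:E.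
Proof. by move=> t0; rewrite lee_fin; exact: (tf_ge0 tf). Qed.

Lemma esum_le1 B (t : R) x : (0 <= t)%R -> \esum_(y in B) (p t x y)%:E <= 1.
Proof.
by move=> t0; rewrite -(tf_mass tf x t0); apply: le_esum_set => // y _; exact: p0.
Qed.

Lemma hitE B (t : R) x : (0 <= t)%R -> (hit B t x)%:E = \esum_(y in B) (p t x y)%:E.
Proof.
move=> t0; apply: ge0_esum_fin => [y _|]; first exact: (tf_ge0 tf).
by rewrite (le_lt_trans (esum_le1 B x t0))// ltry.
Qed.

Lemma hit_ge0 B (t : R) x : (0 <= t)%R -> (0 <= hit B t x)%R.
Proof. by move=> t0; rewrite fine_ge0// esum_ge0// => y _; exact: p0. Qed.

Lemma hit_le1 B (t : R) x : (0 <= t)%R -> (hit B t x <= 1)%R.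
Proof. by move=> t0; rewrite -lee_fin hitE//; exact: esum_le1. Qed.

Lemma hitC B (t : R) x : (0 <= t)%R -> (hit B t x = 1 - hit (~` B) t x)%R.
Proof.
move=> t0; have := tf_mass tf x t0.
rewrite (esumID B)/=; last by move=> y _; exact: p0.
by rewrite !setTI -!hitE// -EFinD => -[<-]; rewrite addrK.
Qed.

Lemma hit_CK B (s t : R) x : (0 <= s)%R -> (0 <= t)%R ->
  (hit B (s + t) x)%:E = \esum_(z in [set: S]) (p s x z * hit B t z)%:E.
Proof.
move=> s0 t0; rewrite hitE ?addr_ge0//.
under eq_esum do rewrite (tf_chapman_kolmogorov tf)//.
rewrite exchange_esum => [|y z _ _]; last by rewrite lee_fin mulr_ge0// (tf_ge0 tf).
apply: eq_esum => z _; rewrite EFinM hitE// -esumZl//; first exact: (tf_ge0 tf).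
by move=> y _; exact: p0.
Qed.

Lemma hit_CK_ge B (s t : R) x (r : seq S) : (0 <= s)%R -> (0 <= t)%R -> uniq r ->
  (\sum_(z <- r) p s x z * hit B t z <= hit B (s + t) x)%R.
Proof.
move=> s0 t0 ur; rewrite -lee_fin hit_CK// -sumEFin; apply: le_sum_esum => // z _.
by rewrite lee_fin mulr_ge0 ?hit_ge0// (tf_ge0 tf).
Qed.

Lemma p_le1 (t : R) x y : (0 <= t)%R -> (p t x y <= 1)%R.
Proof.
move=> t0; rewrite -lee_fin; apply: le_trans (esum_le1 [set y] x t0).
by rewrite esum_set1// p0.
Qed.

Lemma p_le_hit (B : set S) (t : R) x y : (0 <= t)%R -> B y -> (p t x y <= hit B t x)%R.
Proof.
move=> t0 By; rewrite -lee_fin hitE//.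
by apply: (@ge_esum_term R S B (fun y => (p t x y)%:E)) => // z _; exact: p0.
Qed.

Variables (I : eqType) (dom : S -> seq I) (rt : I -> R) (mv : S -> I -> S).
Hypothesis mv_uniq : forall x, uniq [seq mv x i | i <- dom x & mv x i != x].
Hypothesis mv_rate : forall x i, i \in dom x -> mv x i != x ->
  (rt i)%:E <= q x (mv x i).
Hypothesis mv_exit : forall x, \esum_(y in [set y | y != x]) q x y <=
  (\sum_(i <- dom x | mv x i != x) rt i)%:E.

Lemma jump_ge x y (c : R) : x != y -> c%:E <= q x y ->
  forall e : R, (0 < e)%R -> \forall h \near (0:R)^'+, ((c - e) * h <= p h x y)%R.
Proof.
move=> xy cq e e0; have ceq : (c - e)%:E < q x y.
  by apply: lt_le_trans cq; rewrite lte_fin; lra.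
have := tf_rate tf xy (open_nbhs_nbhs (conj (open_ereal_gt_ereal (x := (c - e)%:E)) ceq)).
rewrite nbhs_filterE => L; apply: filterS2 (nbhs_right_gt (0:R)) L => h h0 /=.
by rewrite lte_fin ltr_pdivlMr// => /ltW.
Qed.

Lemma stay_ge x (e : R) : (0 < e)%R -> \forall h \near (0:R)^'+,
  (1 - p h x x <= (\sum_(i <- dom x | mv x i != x) rt i + e) * h)%R.
Proof.
move=> e0; set c := (X in (X + e)%R).
have ceq : \esum_(y in [set y | y != x]) q x y < (c + e)%:E.
  by apply: le_lt_trans (mv_exit x) _; rewrite lte_fin -/c; lra.
have := tf_exit_rate tf (open_nbhs_nbhs (conj (open_ereal_lt_ereal (x := (c + e)%:E)) ceq)).
rewrite nbhs_filterE => L; apply: filterS2 (nbhs_right_gt (0:R)) L => h h0 /=.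
by rewrite lte_fin ltr_pdivrMr// => /ltW.
Qed.

(** Kolmogorov's backward equation, lower half: condition on the state at time
    [h] and keep only the finitely many neighbours of [x] and [x] itself. *)
Lemma hit_dini_ge B (t : R) x : (0 <= t)%R ->
  dini_ge (hit B ^~ x) t (generator dom rt mv (hit B t) x).
Proof.
move=> t0; apply: (@dini_ge_moves R S I dom rt mv (hit B t) x _ t
  (fun i h => p h x (mv x i)) (fun h => p h x x)) => //.
- by move=> y; exact: hit_ge0.
- apply: filterS (nbhs_right_gt (0:R)) => h h0; rewrite (addrC t).
  have := @hit_CK_ge B h t x (x :: [seq mv x i | i <- dom x & mv x i != x]) (ltW h0) t0.
  rewrite /= mv_uniq andbT big_cons big_map big_filter => /(_ _)/wrap[].
    by apply/mapP => -[i]; rewrite mem_filter => /andP[/eqP + _] E; rewrite -E.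
  apply: le_trans; rewrite addrC [in leLHS]mulrC lerD2l le_eqVlt; apply/orP; left.
  by apply/eqP; apply: eq_bigr => i _; rewrite mulrC.
- by move=> i ix im e e0; apply: jump_ge => //; [rewrite eq_sym|exact: mv_rate].
- by move=> e e0; exact: stay_ge.
Qed.

(** The upper half is the lower half for the complement of [B]. *)
Lemma hit_dini_le B (t : R) x : (0 <= t)%R ->
  dini_le (hit B ^~ x) t (generator dom rt mv (hit B t) x).
Proof.
move=> t0 e e0; have := dini_geN 1 (@hit_dini_ge (~` B) t x t0) e0.
apply: filterS2 (nbhs_right_gt (0:R)) => h h0.
rewrite -(gen_cst _ _ _ 1) (hitC B x t0) (hitC B x (t := t + h)) ?addr_ge0// ?(ltW h0)//.
rewrite (_ : hit B t = fun y => (1 - hit (~` B) t y)%R)//.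
by apply/funext => y; exact: hitC.
Qed.

(** The bound does not depend on [s], which gives continuity from the left as
    well as from the right. *)
Lemma hit_increment B (s h : R) x : (0 <= s)%R -> (0 <= h)%R ->
  (`|hit B (s + h) x - hit B s x| <= 1 - p h x x)%R.
Proof.
move=> s0 h0; have sh0 : (0 <= s + h)%R by lra.
have low C : (hit C s x - (1 - p h x x) <= hit C (s + h) x)%R.
  have := @hit_CK_ge C h s x [:: x] h0 s0 isT; rewrite big_seq1 addrC => L.
  apply: le_trans L; rewrite -subr_ge0.
  rewrite (_ : _ - _ = (1 - p h x x) * (1 - hit C s x))%R; last by ring.
  by rewrite mulr_ge0// subr_ge0 ?p_le1 ?hit_le1.
have := low B; have := low (~` B); rewrite (hitC B x s0) (hitC B x sh0) ler_norml; lra.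
Qed.

Lemma p_stay_cvg1 x (e : R) : (0 < e)%R -> exists2 d : R, (0 < d)%R &
  forall h, (0 <= h < d)%R -> (1 - p h x x < e)%R.
Proof.
move=> e0; pose c := (\sum_(i <- dom x | mv x i != x) rt i + 1)%R.
have := stay_ge x (ltr01 : (0 < 1 :> R)%R); rewrite -/c.
rewrite near_withinE => /nbhs_ballP[d /= d0 hd].
pose c' := (`|c| + 1)%R; have c'0 : (0 < c')%R by rewrite /c'; have := normr_ge0 c; lra.
exists ((Num.min d (e / c'))%R); first by rewrite lt_min d0 divr_gt0.
move=> h /andP[h0]; rewrite lt_min => /andP[hd' he].
have [->|hn0] := eqVneq h 0%R; first by rewrite (tf_0 tf) eqxx subrr.
have hp : (0 < h)%R by rewrite lt_neqAle eq_sym hn0.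
apply: (le_lt_trans (hd h _ hp)).
  by rewrite /ball/= sub0r normrN ger0_norm.
apply: (@le_lt_trans _ _ (c' * h)%R).
  by apply: ler_wpM2r => //; rewrite /c'; have := ler_norm c; lra.
by rewrite mulrC -ltr_pdivlMr.
Qed.

Lemma hit_cont B x : cont_nneg (hit B ^~ x).
Proof.
apply/cont_nnegP => t t0 e e0; have [d d0 dP] := p_stay_cvg1 x e0.
exists d => // s s0 st; have [ts|ts] := leP t s.
  have := @hit_increment B t (s - t) x t0 ltac:(lra).
  rewrite (_ : t + (s - t) = s)%R; last by ring.
  move=> /le_lt_trans; apply; apply: dP; move: st; rewrite ger0_norm; lra.
rewrite distrC; have := @hit_increment B s (t - s) x s0 ltac:(lra).
rewrite (_ : s + (t - s) = t)%R; last by ring.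
move=> /le_lt_trans; apply; apply: dP; move: st; rewrite ltr0_norm; lra.
Qed.

End TransitionFunction.

(** * Convergence of reversible kernels *)

Section ReversibleKernel.
Variables (R : realType) (E : choiceType) (D : set E) (k : R -> E -> E -> R)
  (mu : E -> R).
Hypothesis k_ge0 : forall (t : R) x y, 0 <= t -> 0 <= k t x y.
Hypothesis k_mass : forall (t : R) x, 0 <= t -> D x ->
  (\esum_(y in D) (k t x y)%:E = 1)%E.
Hypothesis k_CK : forall (s t : R) x y, 0 <= s -> 0 <= t -> D x -> D y ->
  ((k (s + t) x y)%:E = \esum_(z in D) (k s x z * k t z y)%:E)%E.
Hypothesis mu_gt0 : forall x, D x -> 0 < mu x.
Hypothesis k_rev : forall (t : R) x y, 0 <= t -> D x -> D y ->
  mu x * k t x y = mu y * k t y x.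

Lemma kernel_le1 t x y : 0 <= t -> D x -> D y -> k t x y <= 1.
Proof.
move=> t0 Dx Dy; rewrite -lee_fin -(k_mass t0 Dx).
by apply: (@ge_esum_term R E D (fun y => (k t x y)%:E)) => // z _; rewrite lee_fin k_ge0.
Qed.

Lemma esum_mu_kernel2 s t m : 0 <= s -> 0 <= t -> D m ->
  (\esum_(x in D) (mu x * k s x m * k t x m)%:E = (mu m * k (s + t) m m)%:E)%E.
Proof.
move=> s0 t0 Dm; have mu0 := ltW (mu_gt0 Dm).
rewrite EFinM k_CK// -esumZl//; last first.
  by move=> x Dx; rewrite lee_fin mulr_ge0 ?k_ge0.
by apply: eq_esum => x Dx; rewrite k_rev// -EFinM; congr EFin; ring.
Qed.

Lemma esum_mu_kernel t m : 0 <= t -> D m ->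
  (\esum_(x in D) (mu x * k t x m)%:E = (mu m)%:E)%E.
Proof.
move=> t0 Dm; rewrite -[RHS]mule1 -(k_mass t0 Dm) -esumZl ?(ltW (mu_gt0 Dm))//.
  by apply: eq_esum => x Dx; rewrite k_rev.
by move=> x Dx; rewrite lee_fin k_ge0.
Qed.

(** The left-hand side is one term of the Dirichlet form
    [sum_(x, y) mu x * k s x y * (u x - u y) ^ 2] of [u = k t _ m]. Expanding the
    square and using reversibility turns the form into return probabilities of
    [m]. Moving the cross term to the other side keeps every sum nonnegative. *)
Lemma dirichlet_form_bound s t x y m : 0 <= s -> 0 <= t -> D x -> D y -> D m ->
  mu x * k s x y * (k t x m - k t y m) ^+ 2 <=
  2 * mu m * (k (t + t) m m - k (t + (s + t)) m m).
Proof.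
move=> s0 t0 Dx Dy Dm; pose u z := k t z m.
have u0 z : 0 <= u z by exact: k_ge0.
have w0 z z' : D z -> 0 <= mu z * k s z z'.
  by move=> Dz; rewrite mulr_ge0 ?k_ge0// ltW// mu_gt0.
pose a := mu m * k (t + t) m m; pose b := mu m * k (t + (s + t)) m m.
have uu : (\esum_(z in D) (mu z * u z * u z)%:E = a%:E)%E.
  exact: esum_mu_kernel2.
have mass c z : 0 <= c -> D z -> (\esum_(z' in D) (c * k s z z')%:E = c%:E)%E.
  move=> c0 Dz; rewrite -[RHS]mule1 -(k_mass s0 Dz) -esumZl//.
  by move=> z' _; rewrite lee_fin k_ge0.
have S1 : (\esum_(z in D) \esum_(z' in D) (mu z * k s z z' * (u z * u z))%:E = a%:E)%E.
  rewrite -uu; apply: eq_esum => z Dz; rewrite -(mass (mu z * u z * u z) z)//.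
    by apply: eq_esum => z' _; congr EFin; ring.
  by rewrite !mulr_ge0// ltW// mu_gt0.
have S2 : (\esum_(z in D) \esum_(z' in D) (mu z * k s z z' * (u z' * u z'))%:E = a%:E)%E.
  rewrite exchange_esum => [|z z' Dz Dz']; last by rewrite lee_fin mulr_ge0 ?w0// mulr_ge0.
  rewrite -S1; apply: eq_esum => z Dz; apply: eq_esum => z' Dz'.
  by rewrite k_rev.
have S3 : (\esum_(z in D) \esum_(z' in D) (mu z * k s z z' * (u z * u z'))%:E = b%:E)%E.
  rewrite /b -esum_mu_kernel2 ?addr_ge0//; apply: eq_esum => z Dz.
  rewrite EFinM k_CK// -esumZl.
  - by apply: eq_esum => z' _; rewrite -EFinM; congr EFin; rewrite /u; ring.
  - by rewrite mulr_ge0 ?k_ge0// ltW// mu_gt0.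
  - by move=> z' _; rewrite lee_fin mulr_ge0 ?k_ge0.
have add (f g : E -> E -> R) : (forall z z', D z -> 0 <= f z z') ->
    (forall z z', D z -> 0 <= g z z') ->
    (\esum_(z in D) \esum_(z' in D) (f z z' + g z z')%:E =
     \esum_(z in D) \esum_(z' in D) (f z z')%:E +
     \esum_(z in D) \esum_(z' in D) (g z z')%:E)%E.
  move=> f0 g0. rewrite -esumD; first last.
  - by move=> z Dz; apply: esum_ge0 => z' _; rewrite lee_fin g0.
  - by move=> z Dz; apply: esum_ge0 => z' _; rewrite lee_fin f0.
  apply: eq_esum => z Dz; rewrite -esumD//.
  - by move=> z' _; rewrite lee_fin f0.
  - by move=> z' _; rewrite lee_fin g0.
have sq0 z z' : D z -> 0 <= mu z * k s z z' * (u z - u z') ^+ 2.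
  by move=> Dz; rewrite mulr_ge0 ?w0// sqr_ge0.
have uu0 z z' : D z -> 0 <= mu z * k s z z' * (u z * u z').
  by move=> Dz; rewrite mulr_ge0 ?w0// mulr_ge0.
have S0 : (\esum_(z in D) \esum_(z' in D) (mu z * k s z z' * (u z - u z') ^+ 2)%:E
    + (b%:E + b%:E) = a%:E + a%:E)%E.
  rewrite -{1}S1 -S2 -S3 -!add//;
    try by move=> z z' Dz; rewrite ?addr_ge0 ?uu0// mulr_ge0 ?w0// mulr_ge0.
  by apply: eq_esum => z _; apply: eq_esum => z' _; congr EFin; ring.
rewrite (_ : _ * (_ - _) = (a + a) - (b + b)); last by rewrite /a /b; ring.
rewrite lerBrDr -lee_fin !EFinD -S0 leeD2r//.
apply: le_trans (@ge_esum_term R E D _ x _ Dx); last first.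
  by move=> z Dz; apply: esum_ge0 => z' _; rewrite lee_fin sq0.
apply: (@ge_esum_term R E D (fun z' => (mu x * k s x z' * (u x - u z') ^+ 2)%:E)) => // z' _.
by rewrite lee_fin sq0.
Qed.

(** The Dirichlet form is nonnegative; this is its term [x = y = m]. *)
Lemma return_prob_le m s t : 0 <= s -> 0 <= t -> D m -> k (t + s) m m <= k t m m.
Proof.
move=> s0 t0 Dm; have t20 : 0 <= t / 2 by lra.
have := dirichlet_form_bound s0 t20 Dm Dm Dm.
rewrite subrr expr0n/= mulr0 pmulr_rge0; last by have := mu_gt0 Dm; lra.
by rewrite subr_ge0 (_ : t / 2 + (s + t / 2) = t + s) -?splitr//; lra.
Qed.

(** A nonincreasing function bounded below has vanishing increments. *)
Lemma return_prob_gap m s : 0 <= s -> D m ->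
  k (t + t) m m - k (t + (s + t)) m m @[t --> +oo] --> (0 : R).
Proof.
move=> s0 Dm; apply/cvgrPdist_lt => e e0.
pose A := [set k t m m | t in [set t | 0 <= t]].
have Ainf : has_inf A.
  split; first by exists (k 0 m m); exists 0 => //=.
  by exists 0 => _ [t t0 <-]; exact: k_ge0.
have [_ [T T0 <-] kT] := inf_adherent e0 Ainf.
near=> t.
have t0 : 0 <= t by near: t; exact: nbhs_pinfty_ge.
have tT : T <= t by near: t; apply: nbhs_pinfty_ge; rewrite num_real.
have lo : inf A <= k (t + (s + t)) m m.
  by apply: (ge_inf Ainf.2); exists (t + (s + t)) => //=; lra.
have hi : k (t + t) m m <= k T m m.
  rewrite (_ : t + t = T + (t + t - T)); last by lra.
  by apply: return_prob_le => //; lra.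
have mono : k (t + (s + t)) m m <= k (t + t) m m.
  by rewrite (_ : t + (s + t) = t + t + s); [apply: return_prob_le => //; lra|lra].
rewrite sub0r normrN ger0_norm; lra.
Unshelve. all: by end_near. Qed.

(** By [dirichlet_form_bound], [k t x m] and [k t y m] get close as soon as [y] can be
    reached from [x]. *)
Lemma kernel_diff_cvg0 s x y m : 0 <= s -> D x -> D y -> D m -> 0 < k s x y ->
  k t x m - k t y m @[t --> +oo] --> (0 : R).
Proof.
move=> s0 Dx Dy Dm kxy; apply/cvgrPdist_lt => e e0.
have w0 : 0 < mu x * k s x y by rewrite mulr_gt0// mu_gt0.
pose d := mu x * k s x y * e ^+ 2 / (2 * mu m).
have m0 := mu_gt0 Dm.
have d0 : 0 < d by apply: divr_gt0; [rewrite (mulr_gt0 w0)// exprn_gt0|lra].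
have /cvgrPdist_lt /(_ d d0) := return_prob_gap s0 Dm.
apply: filterS2 (nbhs_pinfty_ge (num_real (0 : R))) => t t0 gap; rewrite sub0r normrN.
have := dirichlet_form_bound s0 t0 Dx Dy Dm.
move: gap; rewrite sub0r normrN ltr_norml => /andP[_ gap] le.
have lt : mu x * k s x y * (k t x m - k t y m) ^+ 2 < mu x * k s x y * e ^+ 2.
  apply: (le_lt_trans le).
  rewrite (_ : _ * e ^+ 2 = 2 * mu m * d); last by rewrite /d; field; lra.
  by rewrite ltr_pM2l//; lra.
rewrite -(ltr_pXn2r (n := 2))// ?nnegrE ?(ltW e0)//.
by move: lt; rewrite ltr_pM2l// real_normK// num_real.
Qed.

(** Invariance says that [k t x m] averages to [mu m] under [mu]. If it
    becomes independent of [x], its common value must be [mu m / Z]. *)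
Theorem reversible_kernel_cvg (Z : R) x0 m : D x0 -> D m ->
  (\esum_(x in D) (mu x)%:E = Z%:E)%E ->
  (forall x, D x -> k t x m - k t x0 m @[t --> +oo] --> (0 : R)) ->
  k t x0 m @[t --> +oo] --> mu m / Z.
Proof.
move=> Dx0 Dm muZ kdiff.
have mu0 x : D x -> 0 <= mu x by move=> /mu_gt0/ltW.
have Z0 : 0 < Z.
  rewrite -lte_fin -muZ; apply: (@lt_le_trans _ _ (mu m)%:E); first by rewrite lte_fin mu_gt0.
  by apply: (@ge_esum_term R E D (fun x => (mu x)%:E)) => // x Dx; rewrite lee_fin mu0.
have pos := nbhs_pinfty_ge (num_real (0 : R)).
have f01 : \forall t \near +oo, forall x, D x -> 0 <= `|k t x m - k t x0 m| <= 1.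
  apply: filterS pos => t t0 x Dx; rewrite normr_ge0/= ler_norml.
  have := k_ge0 x m t0; have := k_ge0 x0 m t0.
  have := kernel_le1 t0 Dx Dm; have := kernel_le1 t0 Dx0 Dm; lra.
have f0 x : D x -> `|k t x m - k t x0 m| @[t --> +oo] --> (0 : R).
  by move=> Dx; apply/norm_cvg0P; exact: kdiff.
have muoo : (\esum_(x in D) (mu x)%:E < +oo)%E by rewrite muZ ltry.
have /fine_cvgP[fin /cvgrPdist_lt cv] : (\esum_(x in D) (mu x * `|k t x m - k t x0 m|)%:E)%E
    @[t --> +oo] --> (0%:E : \bar R).
  exact: esum_cvg0.
apply/cvgrPdist_lt => e e0.
apply: filterS3 pos fin (cv (e * Z) (mulr_gt0 e0 Z0)) => t t0 fint.
rewrite sub0r normrN /=; set dl := fine _.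
have dlE : (dl%:E = \esum_(x in D) (mu x * `|k t x m - k t x0 m|)%:E)%E by rewrite /dl fineK.
have Zk : (\esum_(x in D) (mu x * k t x0 m)%:E = (Z * k t x0 m)%:E)%E.
  rewrite mulrC [RHS]EFinM -muZ -esumZl ?k_ge0//.
  by apply: eq_esum => x _; rewrite mulrC.
have dist : `|mu m - Z * k t x0 m| <= dl.
  apply: (esum_dist mu0 _ _ (esum_mu_kernel t0 Dm) Zk (esym dlE)) => x _; exact: k_ge0.
move=> dle; have dl_lt : dl < e * Z by exact: le_lt_trans (ler_norm _) dle.
rewrite (_ : mu m / Z - k t x0 m = (mu m - Z * k t x0 m) / Z); last by field; rewrite gt_eqF.
rewrite normrM normfV (gtr0_norm Z0) ltr_pdivrMr//; exact: le_lt_trans dl_lt.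
Qed.

End ReversibleKernel.

(** * Configurations, holes and moves *)

Definition mkconfig (f : nat -> int) (fF : configF f) : configF :=
  exist _ f (mem_set fF).

Section Configurations.
Implicit Types (x y : configF) (k n : nat) (d : bool) (c : int).

Lemma configFP x : configF (val x).
Proof. by have := valP x; rewrite inE. Qed.

Lemma config_lt x k : val x k < val x k.+1.
Proof. exact: (configFP x).1. Qed.

Lemma config_le_homo x j k : (j <= k)%N -> val x j <= val x k.
Proof.
move=> jk; apply: (homo_leq (f := val x) (r := <=%R)) => //; first exact: le_trans.
by move=> i; exact/ltW/config_lt.
Qed.

Lemma config_inj x j k : val x j = val x k -> j = k.
Proof.
have lt i l : (i < l)%N -> val x i < val x l.
  by move=> il; apply: lt_le_trans (config_lt x i) _; exact: config_le_homo.
by case: (ltngtP j k) => // /lt + E; rewrite E ltxx.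
Qed.

Definition gap x k : nat := `|holes (val x) k|%N.

Lemma holesE x k : holes (val x) k = (gap x k)%:Z.
Proof. by rewrite /gap /holes; have := config_lt x k; lia. Qed.

Lemma config_succ x k : val x k.+1 = val x k + 1 + (gap x k)%:Z.
Proof. by rewrite -holesE /holes; ring. Qed.

Definition packed_from x n := forall k, (n <= k)%N -> gap x k = 0%N.

Lemma ex_packed_from x : exists n, `[< packed_from x n >].
Proof.
have [_ fin] := configFP x.
have [n nP] : exists n, forall k, val x k.+1 - val x k != 1 -> (k < n)%N.
  have /finite_seqP[s sE] := fin; exists (\max_(i <- s) i).+1 => k gk.
  by rewrite ltnS; apply: leq_bigmax_seq => //; have : [set` s] k by rewrite -sE.
exists n; apply/asboolP => k nk; apply/eqP; apply: contraT => gk.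
suff : (k < n)%N by rewrite ltnNge nk.
by apply: nP; rewrite config_succ; move: gk; lia.
Qed.

Definition front x : nat := ex_minn (ex_packed_from x).

Lemma front_packed x : packed_from x (front x).
Proof. by rewrite /front; case: ex_minnP => n /asboolP. Qed.

Lemma front_le x n : packed_from x n -> (front x <= n)%N.
Proof. by rewrite /front; case: ex_minnP => m _ + nP; apply; apply/asboolP. Qed.

Lemma packed_from_le x m n : (m <= n)%N -> packed_from x m -> packed_from x n.
Proof. by move=> mn mP k nk; apply: mP; apply: leq_trans nk. Qed.

Lemma configF_packed (f : nat -> int) n : config f ->
  (forall k, (n <= k)%N -> f k.+1 = f k + 1) -> configF f.
Proof.
move=> fc fn; split => //; apply: (sub_finite_set _ (finite_II n)) => k /= fk.
by rewrite ltnNge; apply/negP => nk; move/eqP: fk; apply; rewrite fn//; ring.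
Qed.

Definition step d : int := if d then 1 else -1.

Definition shift1 (f : nat -> int) k d : nat -> int :=
  fun j => if j == k then f k + step d else f j.

(** [insubd] returns [x] itself when the shifted sequence is not a configuration,
    which is the suppression of a jump to an occupied site. *)
Definition mv x (i : nat * bool) : configF := insubd x (shift1 (val x) i.1 i.2).

Lemma shift1_neq x k d : shift1 (val x) k d <> val x.
Proof. by move/(congr1 (fun f => f k)); rewrite /shift1 eqxx /step; case: d; lia. Qed.

Lemma configF_shift1 x k d : config (shift1 (val x) k d) -> configF (shift1 (val x) k d).
Proof.
move=> fc; apply: (configF_packed (n := maxn (front x) k.+1)) => // j nj.
rewrite /shift1 !gtn_eqF; [|lia|lia].
by rewrite config_succ (front_packed (x := x))//; lia.
Qed.

Lemma mvP x k d : mv x (k, d) != x <-> config (shift1 (val x) k d).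
Proof.
split=> [|sc].
  apply: contraNP => nsc; apply/eqP; rewrite /mv /insubd insubF//.
  by apply/negbTE/negP; rewrite inE => -[].
apply/eqP => /(congr1 val); rewrite /mv val_insubd mem_set; last exact: configF_shift1.
exact: shift1_neq.
Qed.

Lemma val_mv x k d : mv x (k, d) != x -> val (mv x (k, d)) = shift1 (val x) k d.
Proof.
by move=> /mvP sc; rewrite /mv val_insubd mem_set//; exact: configF_shift1.
Qed.

Lemma mv_rev x k d : mv x (k, d) != x -> mv (mv x (k, d)) (k, ~~ d) = x.
Proof.
move=> mx; set y := mv x (k, d) in mx *.
have E : shift1 (val y) k (~~ d) = val x.
  apply/funext => j; rewrite /shift1 /y val_mv// /shift1 eqxx.
  by case: eqP => [->|//]; rewrite /step; case: (d) => /=; ring.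
apply: val_inj; rewrite val_mv ?E//; apply/mvP; rewrite E.
exact: (configFP x).1.
Qed.

Lemma config_shift1P x k d : config (shift1 (val x) k d) <->
  if d then (0 < gap x k)%N else (k == 0%N) || (0 < gap x k.-1)%N.
Proof.
have xl := config_lt x.
split.
  case: d => sc.
    have := sc k; rewrite /shift1 eqxx gtn_eqF//= config_succ /step /=; lia.
  case: k sc => //= k sc; have := sc k; rewrite /shift1 eqxx ltn_eqF//= config_succ /step /=.
  lia.
move=> ok j; rewrite /shift1; case: (eqVneq j k) => [->|jk].
  rewrite gtn_eqF//; case: d ok => ok; last by have := xl k; rewrite /step /=; lia.
  by rewrite config_succ /step /=; lia.
case: (eqVneq j.+1 k) => [E|//]; move: ok; rewrite -E.
case: d => ok; first by have := xl j; rewrite /step /=; lia.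
by move: ok; rewrite /= config_succ /step /=; lia.
Qed.

Lemma mvE x k d : (mv x (k, d) != x) =
  if d then (0 < gap x k)%N else (k == 0%N) || (0 < gap x k.-1)%N.
Proof. by apply/idP/idP => [/mvP/config_shift1P//|/config_shift1P/mvP]. Qed.

(** Only particles adjacent to a hole move, so finitely many moves are possible:
    a right move needs a hole after the particle, a left move one before it. *)
Lemma mv_front_bound x k d : mv x (k, d) != x -> (k + d <= front x)%N.
Proof.
rewrite mvE; case: d => h.
  by rewrite addn1 ltnNge; apply/negP => /front_packed E; rewrite E in h.
rewrite addn0; case: k h => [|k]//= h; rewrite ltnNge; apply/negP => /front_packed E.
by rewrite E in h.
Qed.

Lemma front_mv x k d : (front (mv x (k, d)) <= maxn (front x) k.+1)%N.
Proof.
have [->|mx] := eqVneq (mv x (k, d)) x; first exact: leq_maxl.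
apply: front_le => j nj; have := config_succ (mv x (k, d)) j.
rewrite val_mv// /shift1 !gtn_eqF; [|lia|lia].
by rewrite config_succ (front_packed (x := x)); lia.
Qed.

Definition moves x : seq (nat * bool) :=
  [seq (k, false) | k <- iota 0 (front x).+1] ++ [seq (k, true) | k <- iota 0 (front x).+1].

Lemma mem_moves x k d : ((k, d) \in moves x) = (k <= front x)%N.
Proof.
rewrite mem_cat; case: d.
  rewrite [X in X || _](_ : _ = false); last by apply/negP => /mapP[].
  by rewrite mem_map ?mem_iota//= => i j [].
rewrite [X in _ || X](_ : _ = false) ?orbF; last by apply/negP => /mapP[].
by rewrite mem_map ?mem_iota//= => i j [].
Qed.

Lemma mv_moves x i : mv x i != x -> i \in moves x.
Proof.
by case: i => k d /mv_front_bound h; rewrite mem_moves; apply: leq_trans h; rewrite leq_addr.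
Qed.

Lemma moves_uniq x : uniq (moves x).
Proof.
have inj d : injective (fun k : nat => (k, d)) by move=> i j [].
rewrite cat_uniq !(map_inj_uniq (inj _)) !iota_uniq andbT.
by apply/hasPn => i /mapP[k _ ->]; apply/mapP => -[].
Qed.

Lemma configF_shift x c : configF (fun k => val x k + c).
Proof.
apply: (configF_packed (n := front x)) => [k|k nk]; first by rewrite ltrD2r config_lt.
by rewrite config_succ (front_packed nk); ring.
Qed.

Definition shift c x : configF := mkconfig (configF_shift x c).

Lemma shiftD c c' x : shift c (shift c' x) = shift (c' + c) x.
Proof. by apply: val_inj; apply/funext => k /=; rewrite addrA. Qed.

Lemma shift0 x : shift 0 x = x.
Proof. by apply: val_inj; apply/funext => k /=; rewrite addr0. Qed.

Lemma gap_shift c x : gap (shift c x) = gap x.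
Proof. by apply/funext => k; rewrite /gap /holes /=; congr absz; ring. Qed.

Lemma gap_eq_shift x y : gap x = gap y -> y = shift (val y 0%N - val x 0%N) x.
Proof.
move=> E; apply: val_inj; apply/funext; elim=> [|k IH] /=; first by ring.
by rewrite !config_succ E IH /=; ring.
Qed.

Lemma front_gap x y : gap x = gap y -> front x = front y.
Proof.
move=> E; apply/eqP; rewrite eqn_leq; apply/andP; split; apply: front_le => k.
  by rewrite E; exact: front_packed.
by rewrite -E; exact: front_packed.
Qed.

Lemma front_shift c x : front (shift c x) = front x.
Proof. by apply: front_gap; rewrite gap_shift. Qed.

Lemma moves_shift c x : moves (shift c x) = moves x.
Proof. by rewrite /moves front_shift. Qed.

Lemma mv_shift c x i : mv (shift c x) i = shift c (mv x i).
Proof.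
case: i => k d; have [E|mx] := eqVneq (mv x (k, d)) x.
  rewrite E; apply/eqP/negPn; rewrite mvE gap_shift -mvE E.
  by rewrite negbK.
have ms : mv (shift c x) (k, d) != shift c x by rewrite mvE gap_shift -mvE.
apply: val_inj; rewrite val_mv//; apply/funext => j /=; rewrite val_mv//= /shift1.
by case: eqP => // _; rewrite /= -addrA [c + _]addrC addrA.
Qed.

Definition norm x : configF := shift (- val x 0%N) x.

Lemma norm0 x : val (norm x) 0%N = 0. Proof. by rewrite /= subrr. Qed.

Lemma gap_norm x : gap (norm x) = gap x. Proof. exact: gap_shift. Qed.

Lemma norm_gap x y : norm x = norm y <-> gap x = gap y.
Proof.
split=> [E|E]; first by rewrite -gap_norm E gap_norm.
by rewrite {1}(gap_eq_shift (esym E)) /norm shiftD /=; congr shift; ring.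
Qed.

Lemma gap_mv x k d j : mv x (k, d) != x ->
  (gap (mv x (k, d)) j)%:Z = (gap x j)%:Z + (if j == k then - step d else 0) +
    (if j.+1 == k then step d else 0).
Proof.
move=> mx; rewrite -!holesE /holes val_mv// /shift1.
case: (eqVneq j k) => [->|jk].
  by rewrite gtn_eqF//; ring.
by case: (eqVneq j.+1 k) => [->|_]; ring.
Qed.

(** Different moves lead to different gap sequences: the moving particle and its
    direction can be read off the change of the gaps. *)
Lemma mv_norm_uniq x : uniq (norm x :: [seq norm (mv x i) | i <- moves x & mv x i != x]).
Proof.
rewrite cons_uniq; apply/andP; split.
  apply/negP => /mapP[[k d]]; rewrite mem_filter => /andP[mx _] /norm_gap E.
  have := gap_mv k mx; rewrite -E eqxx gtn_eqF// /step; case: (d); lia.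
rewrite map_inj_in_uniq; first by rewrite filter_uniq// moves_uniq.
move=> [k d] [k' d']; rewrite !mem_filter => /andP[mx _] /andP[mx' _] /norm_gap E.
have kk j := etrans (esym (gap_mv j mx)) (etrans (congr1 (fun f => Posz (f j)) E) (gap_mv j mx')).
have Sn n : (n.+1 == n) = false by rewrite gtn_eqF.
have K : k = k'.
  have := kk k; have := kk k'; rewrite !eqxx !Sn /step.
  case: (eqVneq k k') => // kk'; rewrite ?(eq_sym k' k) ?(negbTE kk').
  by case: (eqVneq k.+1 k') => h1; case: (eqVneq k'.+1 k) => h2; case: (d); case: (d') => /=; lia.
suff D : d = d' by rewrite K D.
by have := kk k; rewrite -K eqxx Sn /step; case: (d); case: (d') => //=; lia.
Qed.

Lemma mv_uniq x : uniq [seq mv x i | i <- moves x & mv x i != x].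
Proof.
have /andP[_] := mv_norm_uniq x; rewrite (map_comp norm (mv x)).
exact: map_uniq.
Qed.

End Configurations.

(** * Rates, reversible weight and Lyapunov function *)

Section Rates.
Variables (R : realType) (a b : nat -> R).
Hypotheses (a_gt0 : forall k, 0 < a k) (b_gt0 : forall k, 0 < b k).
Implicit Types (x y : configF) (k n : nat) (d : bool).

Definition rate (i : nat * bool) : R := if i.2 then b i.1 else a i.1.

Lemma rate_gt0 i : 0 < rate i. Proof. by rewrite /rate; case: ifP. Qed.

Let q x y := jump_rate a b (val x) (val y).

Lemma jumps_mv x y k d : jumps (val x) k (step d) (val y) <->
  mv x (k, d) != x /\ y = mv x (k, d).
Proof.
split=> [[free E]|[mx ->]].
  have mx : mv x (k, d) != x.
    by apply/mvP; have := (configFP y).1; rewrite E.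
  by split => //; apply: val_inj; rewrite val_mv.
split; last by rewrite val_mv.
move=> j; apply/eqP => E; have jk : j <> k by move=> jk; move: E; rewrite jk /step; case: (d); lia.
have : val (mv x (k, d)) j = val (mv x (k, d)) k.
  by rewrite val_mv// /shift1 eqxx; case: eqP => //.
by move/config_inj/jk.
Qed.

Definition jump_indices x y d := [set k | jumps (val x) k (step d) (val y)].

Lemma jump_rateE x y : jump_rate a b (val x) (val y) =
  (\esum_(k in jump_indices x y false) (rate (k, false))%:E +
   \esum_(k in jump_indices x y true) (rate (k, true))%:E)%E.
Proof. by []. Qed.

Lemma mv_rate x i : i \in moves x -> mv x i != x -> ((rate i)%:E <= q x (mv x i))%E.
Proof.
case: i => k d _ mx; rewrite /q jump_rateE.
have nn e : (0 <= \esum_(k in jump_indices x (mv x (k, d)) e) (rate (k, e))%:E)%E.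
  by apply: esum_ge0 => j _; rewrite lee_fin ltW// rate_gt0.
have term : ((rate (k, d))%:E <=
    \esum_(k in jump_indices x (mv x (k, d)) d) (rate (k, d))%:E)%E.
  apply: (@ge_esum_term R nat _ (fun k => (rate (k, d))%:E)).
    by move=> j _; rewrite lee_fin ltW// rate_gt0.
  by apply/jumps_mv.
by case: d mx nn term => mx nn term; apply: (le_trans term); rewrite ?leeDl ?leeDr.
Qed.

Lemma jump_indices_le x y d :
  (\esum_(k in jump_indices x y d) (rate (k, d))%:E <=
   \sum_(k <- iota 0 (front x).+1 | mv x (k, d) != x)
     if y == mv x (k, d) then (rate (k, d))%:E else 0)%E.
Proof.
set r := [seq k <- iota 0 (front x).+1 | (mv x (k, d) != x) && (y == mv x (k, d))].
apply: (@le_trans _ _ (\esum_(k in [set` r]) (rate (k, d))%:E)%E).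
  apply: le_esum_set => [j _|j /= /jumps_mv[mx E]].
    by rewrite lee_fin ltW// rate_gt0.
  rewrite /r mem_filter E eqxx mx mem_iota add0n ltnS /=.
  by have := mv_moves mx; rewrite mem_moves.
rewrite esum_fset; [|exact: finite_seq|by move=> j _; rewrite lee_fin ltW// rate_gt0].
rewrite -fsbig_seq; last by rewrite filter_uniq// iota_uniq.
by rewrite big_filter big_mkcondr.
Qed.

(** Each target [y] of a jump is reached by a single move, so the exit rate is at
    most the sum of the rates of the moves. *)
Lemma mv_exit x : (\esum_(y in [set y | y != x]) q x y <=
  (\sum_(i <- moves x | mv x i != x) rate i)%:E)%E.
Proof.
pose h i y : \bar R := if y == mv x i then (rate i)%:E else 0%E.
have h0 i y : (0 <= h i y)%E.
  by rewrite /h; case: ifP => // _; rewrite lee_fin ltW// rate_gt0.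
apply: (@le_trans _ _ (\esum_(y in [set y | y != x])
    \sum_(i <- moves x | mv x i != x) h i y)%E).
  apply: le_esum => y _; rewrite /q jump_rateE /moves big_cat !big_map.
  by apply: leeD; exact: jump_indices_le.
rewrite esum_sum; last by [].
rewrite -sumEFin; apply: lee_sum => i mx.
apply: (@le_trans _ _ (\esum_(y in [set mv x i]) (rate i)%:E)%E); last first.
  by rewrite esum_set1// lee_fin ltW// rate_gt0.
rewrite esum_mkcond [leRHS]esum_mkcond; apply: le_esum => y _ /=.
rewrite /h [y \in [set mv x i]](_ : _ = (y == mv x i)); last first.
  by apply/idP/eqP; rewrite inE.
by case: ifP => // _; case: ifP => // _; rewrite lee_fin ltW// rate_gt0.
Qed.

Definition ratio k : R := a k / b k.

Lemma ratio_gt0 k : 0 < ratio k. Proof. by rewrite divr_gt0. Qed.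

Lemma alpha_ratio n : alpha a b n = \prod_(i < n) ratio i.
Proof. by rewrite /alpha -prodf_div. Qed.

Lemma alpha_gt0 n : 0 < alpha a b n.
Proof. by rewrite alpha_ratio; apply: prodr_gt0 => i _; exact: ratio_gt0. Qed.

Definition weight x : R := \prod_(k < front x) alpha a b k.+1 ^+ gap x k.

Lemma weight_gt0 x : 0 < weight x.
Proof. by apply: prodr_gt0 => i _; rewrite exprn_gt0// alpha_gt0. Qed.

Lemma weightE n x : packed_from x n ->
  weight x = \prod_(k < n) alpha a b k.+1 ^+ gap x k.
Proof.
move=> xn; rewrite /weight -!(big_mkord xpredT (fun k => alpha a b k.+1 ^+ gap x k)).
rewrite [RHS](big_cat_nat (n := front x))//=; last exact: front_le.
rewrite [X in _ * X]big_nat_cond [X in _ * X]big1 ?mulr1// => k /andP[/andP[fk _] _].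
by rewrite (front_packed fk).
Qed.

Lemma weight_shift c x : weight (shift c x) = weight x.
Proof. by rewrite /weight front_shift gap_shift. Qed.

(** The number of holes between the [k]th particle and the [n]th; for [n] beyond
    the last hole, the number of holes to the right of the [k]th particle. *)
Definition holes_right x n k : nat :=
  absz (val x n - val x k - (n%:Z - k%:Z))%R.


Lemma holes_right_eq x n k : (k <= n)%N ->
  (holes_right x n k)%:Z = val x n - val x k - (n%:Z - k%:Z).
Proof.
rewrite /holes_right => kn; rewrite gez0_abs//.
elim: n kn => [|n IH]; first by rewrite leqn0 => /eqP->; lia.
rewrite leq_eqVlt => /predU1P[->|/IH]; first by lia.
rewrite config_succ; lia.
Qed.

(** Since [alpha k.+1] is the product of [ratio i] for [i <= k], a hole
    contributes one factor [ratio i] for each particle [i] to its left. In this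
    form the effect of a move on the weight is visible. *)
Lemma weight_ratio n x : packed_from x n ->
  weight x = \prod_(k < n) ratio k ^+ holes_right x n k.
Proof.
move=> xn; rewrite (weightE xn) {xn}; elim: n => [|n IH]; first by rewrite !big_ord0.
rewrite big_ord_recr/= IH alpha_ratio -prodrXl [RHS]big_ord_recr/=.
rewrite [X in _ * X]big_ord_recr/= mulrA -big_split/=.
congr (_ * _); last first.
  congr (_ ^+ _); apply/eqP; rewrite -eqz_nat holes_right_eq// config_succ; lia.
apply: eq_bigr => i _; rewrite -exprD; congr (_ ^+ _); apply/eqP.
rewrite -eqz_nat PoszD !holes_right_eq ?config_succ//; have := ltn_ord i; lia.
Qed.

(** A left move of particle [k] puts one more hole to its right and changes
    nothing for the other particles: the weight gains a factor [a k / b k]. *)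
Lemma weight_rev x k d : mv x (k, d) != x ->
  weight x * rate (k, d) = weight (mv x (k, d)) * rate (k, ~~ d).
Proof.
suff left y : mv y (k, false) != y -> weight y * a k = weight (mv y (k, false)) * b k.
  case: d => mx; last exact: left.
  have my : mv (mv x (k, true)) (k, false) != mv x (k, true).
    by rewrite (mv_rev mx) eq_sym.
  by have := left _ my; rewrite (mv_rev (d := true) mx).
move=> my; pose n := maxn (front y) k.+1.
have yn : packed_from y n by apply: packed_from_le (@front_packed y); exact: leq_maxl.
have zn : packed_from (mv y (k, false)) n.
  by apply: packed_from_le (@front_packed _); exact: front_mv.
have kn : (k < n)%N by exact: leq_maxr.
rewrite (weight_ratio yn) (weight_ratio zn).
rewrite [in LHS](bigD1 (Ordinal kn))//= [in RHS](bigD1 (Ordinal kn))//=.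
have -> : holes_right (mv y (k, false)) n k = (holes_right y n k).+1.
  apply/eqP; rewrite -eqz_nat -addn1 PoszD !holes_right_eq ?(ltnW kn)// val_mv//.
  by rewrite /shift1 eqxx gtn_eqF// /step; lia.
rewrite exprSr -[_ * ratio k]/(_ * (a k / b k)).
set P := \prod_(i < n | _) _; set P' := \prod_(i < n | _) _.
have -> : P' = P.
  apply: eq_bigr => i; rewrite -(inj_eq val_inj)/= => ik; congr (_ ^+ _).
  by rewrite /holes_right val_mv// /shift1 gtn_eqF// (negbTE ik).
by field; rewrite gt_eqF.
Qed.

(** A Lyapunov function that rules out explosion: the last hole moves to the right
    only when the particle just after it jumps left, at rate [a (front x)], and
    this increases [depth] by [(a (front x))^-1]. *)
Definition depth x : R := \sum_(k < front x) (a k)^-1.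

Lemma depth_le x y : (front x <= front y)%N -> depth x <= depth y.
Proof.
move=> xy; rewrite /depth -!(big_mkord xpredT (fun k => (a k)^-1)).
rewrite [leRHS](big_cat_nat (n := front x))//= lerDl sumr_ge0// => i _.
by rewrite invr_ge0 ltW.
Qed.

Lemma depth_ge0 x : 0 <= depth x.
Proof. by apply: sumr_ge0 => i _; rewrite invr_ge0 ltW. Qed.

Lemma depth_gen x : generator moves rate mv depth x <= 1.
Proof.
have le0 i : i != (front x, false) -> depth (mv x i) - depth x <= 0.
  case: i => k d; have [->|mx ni] := eqVneq (mv x (k, d)) x; first by rewrite subrr.
  rewrite subr_le0; apply: depth_le; apply: leq_trans (front_mv x k d) _.
  rewrite geq_max leqnn/=; have := mv_front_bound mx; case: d ni {mx} => ni.
    by rewrite addn1.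
  rewrite addn0 leq_eqVlt => /predU1P[E|//]; by rewrite E eqxx in ni.
rewrite /generator (bigD1_seq (front x, false)) ?moves_uniq ?mem_moves//=.
(* every move but the left jump of particle [front x] leaves the last hole in
   place or moves it left *)
have rest : \sum_(i <- moves x | i != (front x, false)) rate i * (depth (mv x i) - depth x) <= 0.
  by apply: sumr_le0 => i ni; rewrite pmulr_rle0 ?rate_gt0// le0.
have top : a (front x) * (depth (mv x (front x, false)) - depth x) <= 1.
  rewrite mulrC -ler_pdivlMr// div1r lerBlDr /depth.
  apply: (@le_trans _ _ (\sum_(k < (front x).+1) (a k)^-1)).
    rewrite -!(big_mkord xpredT (fun k => (a k)^-1)).
    rewrite [leRHS](big_cat_nat (n := front (mv x (front x, false))))//=.
      by rewrite lerDl sumr_ge0// => i _; rewrite invr_ge0 ltW.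
    by apply: leq_trans (front_mv _ _ _) _; rewrite geq_max leqnSn leqnn.
  by rewrite big_ord_recr/= addrC.
rewrite /rate/=; rewrite /rate/= in rest; lra.
Qed.

Hypothesis sum_inv_a : (\sum_(0 <= k <oo) ((a k)^-1)%:E = +oo)%E.

(** Since the sum of [(a k)^-1] diverges, bounded [depth] means bounded [front],
    hence boundedly many possible moves with bounded rates. *)
Lemma depth_rate L : exists C, forall x, depth x <= L ->
  \sum_(i <- moves x) rate i <= C.
Proof.
have [n0 n0L] : exists n, L < \sum_(k < n) (a k)^-1.
  apply: contrapT => /forallNP H.
  have : (\sum_(0 <= k <oo) ((a k)^-1)%:E <= L%:E)%E.
    apply: lime_le.
      by apply: is_cvg_ereal_nneg_natsum => n _; rewrite lee_fin invr_ge0 ltW.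
    apply: nearW => n; rewrite big_mkord sumEFin lee_fin leNgt; exact/negP.
  by rewrite sum_inv_a.
exists (\sum_(0 <= k < n0.+1) (a k + b k)) => x xL.
have fx : (front x < n0)%N.
  rewrite ltnNge; apply/negP => fx.
  have : \sum_(k < n0) (a k)^-1 <= depth x.
    rewrite /depth -!(big_mkord xpredT (fun k => (a k)^-1)).
    rewrite [leRHS](big_cat_nat (n := n0))//= lerDl sumr_ge0// => i _.
    by rewrite invr_ge0 ltW.
  by move=> /le_trans /(_ xL); rewrite leNgt n0L.
have -> : \sum_(i <- moves x) rate i = \sum_(k <- iota 0 (front x).+1) (a k + b k).
  by rewrite /moves big_cat !big_map [RHS]big_split.
rewrite (_ : iota _ _ = index_iota 0 (front x).+1); last first.
  by rewrite /index_iota subn0.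
rewrite [leRHS](big_cat_nat (n := (front x).+1))//=; last by rewrite ltnS ltnW.
by rewrite lerDl sumr_ge0// => i _; rewrite addr_ge0 ?ltW.
Qed.

End Rates.

(** * The kernel on translation classes *)

Section LumpedKernel.
Variables (R : realType) (a b : nat -> R).
Hypotheses (a_gt0 : forall k, 0 < a k) (b_gt0 : forall k, 0 < b k).
Hypothesis sum_inv_a : (\sum_(0 <= k <oo) ((a k)^-1)%:E = +oo)%E.
Variable p : R -> configF -> configF -> R.
Hypothesis tf : transition_function
  (fun x y : configF => jump_rate a b (val x) (val y)) p.
Implicit Types (x y z : configF) (c : int) (t s : R).

Local Notation rt := (rate a b).
Local Notation gen := (generator moves rt mv).
Let mv_rate' := mv_rate a_gt0 b_gt0.
Let mv_exit' := mv_exit a_gt0 b_gt0.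

Definition same_gaps y : set configF := [set z | gap z = gap y].

(** The transition probability between the gap sequences of [x] and [y]; the
    particles drift, so only the gaps can be positive recurrent. *)
Definition lumped t x y : R := hit p (same_gaps y) t x.

Lemma hit0_in (B : set configF) x : B x -> hit p B 0 x = 1.
Proof.
move=> Bx; apply/eqP; rewrite eq_le (hit_le1 tf)//=.
by have := p_le_hit tf x (lexx (0 : R)) Bx; rewrite (tf_0 tf) eqxx.
Qed.

Lemma hit0_notin (B : set configF) x : ~ B x -> hit p B 0 x = 0.
Proof.
move=> nBx; rewrite /hit esum1// => y By; rewrite (tf_0 tf).
by case: eqP => // E; case: nBx; rewrite E.
Qed.

(** Nonexplosion in the form in which it is used: the maximum principle with the
    Lyapunov function [depth]. *)
Lemma subsolution_le0 (w : R -> configF -> R) (K : R) :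
  (forall t x, 0 <= t -> w t x <= K) -> (forall x, w 0 x <= 0) ->
  (forall x, cont_nneg (w ^~ x)) ->
  (forall t x, 0 <= t -> dini_le (w ^~ x) t (gen (w t) x)) ->
  forall t x, 0 <= t -> w t x <= 0.
Proof.
apply: (@maximum_principle R _ _ moves rt mv (depth a)).
- by move=> i; apply/ltW/rate_gt0.
- exact: depth_ge0.
- exact: depth_gen.
- exact: depth_rate.
Qed.

(** The transition function is arbitrary with the given rates, so its translation
    invariance is not built in. Both sides solve the backward equation with the
    same initial value; [subsolution_le0] applies to their difference. *)
Lemma lumped_shiftl t c x y : 0 <= t -> lumped t (shift c x) y = lumped t x y.
Proof.
move=> t0; suff le c' z : lumped t z y <= lumped t (shift c' z) y.
  apply/eqP; rewrite eq_le le andbT.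
  by have := le (- c) (shift c x); rewrite shiftD subrr shift0.
rewrite -subr_le0.
apply: (@subsolution_le0 (fun t x => lumped t x y - lumped t (shift c' x) y) 1) => //.
- move=> s x' s0; have := hit_le1 tf (same_gaps y) x' s0.
  by have := hit_ge0 tf (same_gaps y) (shift c' x') s0; rewrite /lumped; lra.
- move=> x'; have [yx|yx] := pselect (same_gaps y x').
    by rewrite /lumped !hit0_in ?subrr//= /same_gaps /= gap_shift.
  by rewrite /lumped !hit0_notin ?subrr//= /same_gaps /= gap_shift.
- move=> x'; apply: cont_nnegB.
    by apply: (hit_cont tf mv_exit').
  by apply: (hit_cont tf mv_exit').
- move=> s x' s0; rewrite genB; apply: dini_leB.
    exact: (hit_dini_le tf mv_uniq mv_rate' mv_exit').
  have -> : gen (fun y0 => lumped s (shift c' y0) y) x' = gen ((lumped s) ^~ y) (shift c' x').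
    by rewrite /generator moves_shift; apply: eq_bigr => i _; rewrite mv_shift.
  exact: (hit_dini_ge tf mv_uniq mv_rate' mv_exit').
Qed.

Lemma lumped_shiftr t c x y : lumped t x (shift c y) = lumped t x y.
Proof. by rewrite /lumped /same_gaps gap_shift. Qed.

Lemma lumped_norml t x y : 0 <= t -> lumped t (norm x) y = lumped t x y.
Proof. exact: lumped_shiftl. Qed.

Lemma lumped_normr t x y : lumped t x (norm y) = lumped t x y.
Proof. exact: lumped_shiftr. Qed.

Lemma lumped_ge0 t x y : 0 <= t -> 0 <= lumped t x y.
Proof. exact: (hit_ge0 tf). Qed.

(** Configurations with first particle at 0 represent the translation classes. *)
Definition anchored : set configF := [set x | val x 0%N = 0].

Lemma anchored_norm x : anchored (norm x).
Proof. exact: norm0. Qed.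

Lemma norm_id x : anchored x -> norm x = x.
Proof. by move=> x0; rewrite /norm x0 oppr0 shift0. Qed.

Lemma esum_anchored (f : configF -> \bar R) : (forall x, (0 <= f x)%E) ->
  (\esum_(x in [set: configF]) f x =
   \esum_(y in anchored) \esum_(x in same_gaps y) f x)%E.
Proof.
move=> f0; rewrite esum_esum//.
rewrite (@reindex_esum R _ _ (anchored `*`` same_gaps) [set: configF]
  (fun z : configF * configF => z.2) f)//.
split=> //.
- move=> [y x] [y' x'] /[!inE] -[/= Ay gx] [/= Ay' gx'] E; rewrite E in gx *.
  congr (_, _); rewrite -(norm_id Ay) -(norm_id Ay'); apply/norm_gap.
  by rewrite -gx -gx'.
- move=> x _; exists (norm x, x) => //=; split; first exact: anchored_norm.
  by rewrite /= /same_gaps/= gap_norm.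
Qed.

Lemma lumped_mass t x : 0 <= t -> (\esum_(y in anchored) (lumped t x y)%:E = 1)%E.
Proof.
move=> t0; rewrite -(tf_mass tf x t0) esum_anchored; last first.
  by move=> y; rewrite lee_fin (tf_ge0 tf).
by apply: eq_esum => y _; rewrite (hitE tf).
Qed.

(** Translation invariance is what makes the lumped kernel Markov: the second
    factor depends on the intermediate state only through its class. *)
Lemma lumped_CK s t x y : 0 <= s -> 0 <= t ->
  ((lumped (s + t) x y)%:E =
   \esum_(z in anchored) (lumped s x z * lumped t z y)%:E)%E.
Proof.
move=> s0 t0; rewrite (hit_CK tf)// esum_anchored; last first.
  by move=> z; rewrite lee_fin mulr_ge0 ?(tf_ge0 tf)// lumped_ge0.
apply: eq_esum => z _; rewrite mulrC EFinM [X in (_ * X)%E](hitE tf)//.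
rewrite -esumZl ?lumped_ge0//; last by move=> z' _; rewrite lee_fin (tf_ge0 tf).
apply: eq_esum => z' zz'; rewrite -EFinM mulrC; congr (_ * _)%:E.
by rewrite -[RHS]lumped_norml// -[LHS]lumped_norml//; congr lumped; apply/norm_gap.
Qed.

Lemma lumped_CK_ge s t x y (r : seq configF) : 0 <= s -> 0 <= t ->
  uniq [seq norm z | z <- r] ->
  \sum_(z <- r) lumped s x z * lumped t z y <= lumped (s + t) x y.
Proof.
move=> s0 t0 ur; rewrite -lee_fin lumped_CK// -sumEFin.
have := @le_sum_esum R configF anchored (fun z => (lumped s x z * lumped t z y)%:E) _ ur.
rewrite big_map; under eq_bigr do rewrite lumped_normr lumped_norml//.
apply; first by move=> z /mapP[z' _ ->]; exact: anchored_norm.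
by move=> z _; rewrite lee_fin mulr_ge0// lumped_ge0.
Qed.

Lemma p_le_lumped t x y : 0 <= t -> p t x y <= lumped t x y.
Proof. by move=> t0; apply: (p_le_hit tf). Qed.

Lemma jump_near x i : mv x i != x -> forall e, 0 < e ->
  \forall h \near (0 : R)^'+, (rt i - e) * h <= lumped h x (mv x i).
Proof.
move=> mx e e0; have xm : x != mv x i by rewrite eq_sym.
apply: filterS2 (nbhs_right_gt (0 : R)) (jump_ge tf xm (mv_rate' (mv_moves mx) mx) e0).
by move=> h h0 /le_trans; apply; apply: p_le_lumped; exact: ltW.
Qed.

(** Forward inequality for [lumped t x y] as a function of [y]: the last jump comes
    from one of the finitely many neighbours of [y]. Dividing by the weight turns
    the adjoint of the generator into the generator, by [weight_rev]. *)
Lemma lumped_forward t x y : 0 <= t ->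
  dini_ge (fun s => weight a b x / weight a b y * lumped s x y) t
    (gen (fun z => weight a b x / weight a b z * lumped t x z) y).
Proof.
move=> t0; have w0 z : 0 < weight a b z by exact: weight_gt0.
apply: (@dini_ge_moves R _ _ moves rt mv _ y _ t
  (fun i h => weight a b (mv y i) / weight a b y * lumped h (mv y i) y)
  (fun h => lumped h y y)) => //.
- by move=> z; rewrite mulr_ge0 ?lumped_ge0// divr_ge0// ltW.
- apply: filterS (nbhs_right_gt (0:R)) => h h0.
  have := @lumped_CK_ge t h x y (y :: [seq mv y i | i <- moves y & mv y i != y]) t0 (ltW h0).
  rewrite [map _ _]/= -map_comp => /(_ (mv_norm_uniq y)).
  rewrite big_cons big_map big_filter => L.
  apply: le_trans (ler_wpM2l _ L); last by rewrite divr_ge0// ltW.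
  rewrite mulrDr addrC mulrA lerD2l mulr_sumr le_eqVlt; apply/orP; left.
  apply/eqP; apply: eq_bigr => i _; field.
  by rewrite !gt_eqF.
- move=> [k d] _ my e e0.
  have c0 : 0 < weight a b (mv y (k, d)) / weight a b y by rewrite divr_gt0.
  have mr : mv (mv y (k, d)) (k, ~~ d) != mv y (k, d) by rewrite (mv_rev my) eq_sym.
  have := jump_near mr (divr_gt0 e0 c0); rewrite (mv_rev my).
  apply: filterS => h /(ler_wpM2l (ltW c0)); apply: le_trans.
  rewrite mulrA le_eqVlt; apply/orP; left; apply/eqP; congr (_ * _).
  have := weight_rev a b_gt0 my => E.
  rewrite [RHS]mulrBr; congr (_ - _); last by rewrite mulrC divfK ?gt_eqF.
  apply: (mulfI (lt0r_neq0 (w0 y))); rewrite E; field.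
  by rewrite gt_eqF.
- move=> e e0.
  apply: filterS2 (nbhs_right_gt (0:R)) (stay_ge tf mv_exit' y e0) => h h0.
  by have := p_le_lumped y y (ltW h0); lra.
Qed.

(** The two kernels [lumped t y x] and [weight x / weight y * lumped t x y] agree
    at time 0; as functions of [y] the first solves the backward equation and the
    second is a supersolution of it. So the maximum principle gives one
    inequality for all pairs, and exchanging [x] and [y] gives the other. *)
Lemma detailed_balance t x y : 0 <= t ->
  weight a b x * lumped t x y = weight a b y * lumped t y x.
Proof.
move=> t0; have w0 z : 0 < weight a b z by exact: weight_gt0.
suff le x' y' : weight a b y' * lumped t y' x' <= weight a b x' * lumped t x' y'.
  by apply/eqP; rewrite eq_le !le.
rewrite -ler_pdivlMl// mulrA [_^-1 * _]mulrC -subr_le0.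
apply: (@subsolution_le0 (fun t y => lumped t y x' -
  weight a b x' / weight a b y * lumped t x' y) 1) => //.
- move=> s z s0; have := hit_le1 tf (same_gaps x') z s0; rewrite -/(lumped s z x').
  have : 0 <= weight a b x' / weight a b z * lumped s x' z.
    by rewrite mulr_ge0 ?lumped_ge0// divr_ge0// ltW.
  lra.
- move=> z; have [zx|zx] := pselect (gap z = gap x').
    have zx' : same_gaps z x' by exact: esym.
    rewrite /lumped !hit0_in//.
    rewrite /weight (front_gap zx) zx divff ?mulr1 ?subrr//.
    by rewrite gt_eqF//; exact: weight_gt0.
  rewrite /lumped hit0_notin// sub0r oppr_le0 mulr_ge0 ?lumped_ge0//.
  by rewrite divr_ge0// ltW.
- move=> z; apply: cont_nnegB; first exact: (hit_cont tf mv_exit').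
  move=> s s0; apply: cvgM; first exact: cvg_cst.
  exact: (hit_cont tf mv_exit').
- move=> s z s0; rewrite genB; apply: dini_leB.
    exact: (hit_dini_le tf mv_uniq mv_rate' mv_exit').
  exact: lumped_forward.
Qed.

Lemma lumped_diff_move x i m :
  lumped t x m - lumped t (mv x i) m @[t --> +oo] --> (0 : R).
Proof.
have pos := nbhs_pinfty_ge (num_real (0 : R)).
have [->|mx] := eqVneq (mv x i) x.
  by under eq_fun do rewrite subrr; exact: cvg_cst.
have r0 : 0 < rt i / 2 by rewrite divr_gt0 ?rate_gt0.
have [s /andP[s0 _] sP] := near0_lt ltr01 (jump_near mx r0).
have ls : 0 < lumped s (norm x) (norm (mv x i)).
  rewrite lumped_normr lumped_norml ?ltW//; apply: lt_le_trans sP.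
  by rewrite mulr_gt0//; lra.
have := @kernel_diff_cvg0 R configF anchored lumped (weight a b) lumped_ge0
  (fun t x ht _ => lumped_mass x ht) (fun s t x y hs ht _ _ => lumped_CK x y hs ht)
  (fun x _ => weight_gt0 a_gt0 b_gt0 x) (fun t x y ht _ _ => detailed_balance x y ht)
  s (norm x) (norm (mv x i)) (norm m) (ltW s0) (anchored_norm _) (anchored_norm _)
  (anchored_norm _) ls.
apply: cvg_trans; apply: near_eq_cvg; apply: filterS pos => t t0.
by rewrite !lumped_normr !lumped_norml.
Qed.

(** Configurations are connected: a right move of the particle just before the
    last nonempty gap takes a hole out of that gap, so this gap can be emptied,
    and inductively all of them. *)
Lemma lumped_diff x y m : lumped t x m - lumped t y m @[t --> +oo] --> (0 : R).
Proof.
have pos := nbhs_pinfty_ge (num_real (0 : R)).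
pose merge x y := lumped t x m - lumped t y m @[t --> +oo] --> (0 : R).
have merge_gap x' y' : gap x' = gap y' -> merge x' y'.
  move=> E; apply/cvgrPdist_lt => e e0; apply: filterS pos => t t0.
  rewrite -(@lumped_norml t x')// -(@lumped_norml t y')//.
  by rewrite (_ : norm x' = norm y') ?subrr ?subr0 ?normr0//; exact/norm_gap.
have merge_trans x' y' z' : merge x' y' -> merge y' z' -> merge x' z'.
  move=> xy yz; rewrite /merge.
  have -> : (fun t => lumped t x' m - lumped t z' m) = 
      (fun t => (lumped t x' m - lumped t y' m) + (lumped t y' m - lumped t z' m)).
    by apply/funext => t; ring.
  have := cvgD xy yz; rewrite addr0; exact.
have merge_sym x' y' : merge x' y' -> merge y' x'.
  move=> xy; rewrite /merge.
  have -> : (fun t => lumped t y' m - lumped t x' m) = 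
      (fun t => - (lumped t x' m - lumped t y' m)).
    by apply/funext => t; ring.
  have := cvgN xy; rewrite oppr0; exact.
suff packed n : forall x' y', packed_from x' n -> packed_from y' 0 -> merge x' y'.
  have pk : packed_from (mkconfig (configF_packed (f := fun k => k%:Z) (n := 0)
     (fun k => ltac:(lia)) (fun k _ => ltac:(lia)))) 0.
    by move=> k _; rewrite /gap /holes/=; lia.
  by apply: merge_trans (packed _ _ _ (@front_packed x) pk)
    (merge_sym _ _ (packed _ _ _ (@front_packed y) pk)).
elim: n => [|n IH] x' y' xn y0.
  by apply: merge_gap; apply/funext => k; rewrite xn ?y0.
move: {2}(gap x' n) (erefl (gap x' n)) => j; elim: j x' xn => [|j IHj] x' xn xj.
  apply: IH => // k; rewrite leq_eqVlt => /predU1P[<-//|]; exact: xn.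
have mx : mv x' (n, true) != x' by rewrite mvE xj.
apply: merge_trans (lumped_diff_move x' (n, true) m) _; apply: IHj.
  move=> k nk; have := gap_mv k mx; rewrite xn// !gtn_eqF//; [lia|exact: ltnW].
by have := gap_mv n mx; rewrite xj eqxx gtn_eqF// /step; lia.
Qed.

Theorem lumped_cvg (Z : R) x m :
  (\esum_(y in anchored) (weight a b y)%:E = Z%:E)%E ->
  lumped t x m @[t --> +oo] --> weight a b m / Z.
Proof.
move=> wZ; have pos := nbhs_pinfty_ge (num_real (0 : R)).
rewrite -(weight_shift a b (- val m 0%N)) -/(norm m).
have := @reversible_kernel_cvg R configF anchored lumped (weight a b) lumped_ge0
  (fun t x ht _ => lumped_mass x ht)
  (fun x _ => weight_gt0 a_gt0 b_gt0 x) (fun t x y ht _ _ => detailed_balance x y ht)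
  Z (norm x) (norm m) (anchored_norm _) (anchored_norm _) wZ
  (fun x _ => lumped_diff _ _ _).
apply: cvg_trans; apply: near_eq_cvg; apply: filterS pos => t t0.
by rewrite !lumped_normr !lumped_norml.
Qed.

End LumpedKernel.

(** * Total mass of the weight *)

Section ConfigOf.
Implicit Types (g : nat -> nat) (x y : configF).

(** The configuration with first particle at 0 whose first [n] gaps are given by
    [g] and whose other gaps are empty. *)
Definition config_of_fun g n k : int := (k + \sum_(i < k) (if (i < n)%N then g i else 0))%N%:Z.

Lemma config_of_succ g n k : config_of_fun g n k.+1 =
  config_of_fun g n k + 1 + (if (k < n)%N then g k else 0%N)%:Z.
Proof. by rewrite /config_of_fun big_ord_recr/=; lia. Qed.

Lemma config_of_configF g n : configF (config_of_fun g n).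
Proof.
apply: (configF_packed (n := n)) => [k|k nk]; rewrite config_of_succ; first by lia.
by rewrite ltnNge nk addr0.
Qed.

Definition config_of g n : configF := mkconfig (config_of_configF g n).

Lemma gap_config_of g n k : gap (config_of g n) k = if (k < n)%N then g k else 0%N.
Proof. by apply/eqP; rewrite -eqz_nat -holesE /holes /= config_of_succ; lia. Qed.

Lemma anchored_config_of g n : anchored (config_of g n).
Proof. by rewrite /anchored/= /config_of_fun big_ord0. Qed.

Lemma packed_config_of g n : packed_from (config_of g n) n.
Proof. by move=> k nk; rewrite gap_config_of ltnNge nk. Qed.

Lemma anchored_inj x y : anchored x -> anchored y -> gap x = gap y -> x = y.
Proof.
by move=> Ax Ay /gap_eq_shift ->; rewrite Ax Ay subrr shift0.
Qed.

Lemma countable_configF : countable [set: configF].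
Proof.
apply/countable_injP.
exists (fun x => choice.pickle (val x 0%N, [seq gap x k | k <- iota 0 (front x)])).
move=> x y _ _ /(pcan_inj choice.pickleK)[x0 E].
suff gE : gap x = gap y.
  by have := gap_eq_shift gE; rewrite -[val y 0%N]x0 subrr shift0.
have fE : front x = front y by have := congr1 size E; rewrite !size_map !size_iota.
apply/funext => k; have [kf|kf] := ltnP k (front x); last first.
  by rewrite !front_packed// -?fE.
have := congr1 (nth 0%N ^~ k) E.
by rewrite !(nth_map 0%N) ?size_iota -?fE// !nth_iota -?fE.
Qed.

End ConfigOf.

Section PartitionFunction.
Variables (R : realType) (a b : nat -> R).
Hypotheses (a_gt0 : forall k, 0 < a k) (b_gt0 : forall k, 0 < b k).
Hypothesis sum_inv_a : (\sum_(0 <= k <oo) ((a k)^-1)%:E = +oo)%E.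
Hypothesis calV_neq0 : calV a b !=set0.
Hypothesis sum_alpha : (\sum_(0 <= k <oo) (alpha a b k)%:E < +oo)%E.

Local Notation alpha := (alpha a b).
Local Notation weight := (weight a b).
Let alpha_gt0' k : 0 < alpha k. Proof. exact: alpha_gt0. Qed.

Lemma sum_alpha_bound : exists M, forall n, \sum_(k < n) alpha k <= M.
Proof.
exists (fine (\sum_(0 <= k <oo) (alpha k)%:E)%E) => n.
have s0 : (0 <= \sum_(0 <= k <oo) (alpha k)%:E)%E.
  by apply: nneseries_ge0 => k _ _; rewrite lee_fin ltW.
rewrite -lee_fin fineK ?ge0_fin_numE// -sumEFin -(big_mkord xpredT (fun k => (alpha k)%:E)).
by apply: nneseries_lim_ge => k _ _; rewrite lee_fin ltW.
Qed.

Lemma betaE k : beta a b k = alpha k * \sum_(j < k) (a j * alpha j)^-1.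
Proof.
have an0 i : a i != 0 by rewrite gt_eqF.
have bn0 i : b i != 0 by rewrite gt_eqF.
rewrite /beta mulr_sumr; apply: eq_bigr => j _.
have pn0 (c : nat -> R) (r : seq nat) : (forall i, c i != 0) -> \prod_(i <- r) c i != 0.
  by move=> cn0; rewrite prodf_seq_neq0; apply/allP => i _; rewrite cn0.
rewrite /Defs.alpha -!(big_mkord xpredT a) -!(big_mkord xpredT b).
have split_at (c : nat -> R) : \prod_(0 <= i < k) c i =
    \prod_(0 <= i < j) c i * \prod_(j <= i < k) c i.
  by rewrite (big_cat_nat (n := j))//=; exact: ltnW.
rewrite !split_at [\prod_(j <= i < k) a i]big_ltn//.
by field; rewrite !pn0 ?an0.
Qed.

(** If [v >= 0] then [alpha k.+1 <= alpha k.+1 + v * beta k.+1 < 1]. If [v < 0],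
    positivity of [alpha k.+1 + v * beta k.+1] bounds the sums of
    [(a j * alpha j)^-1]; as [alpha] is bounded, the sum of [(a j)^-1] would
    be finite. *)
Lemma alpha_lt1 k : alpha k.+1 < 1.
Proof.
have [v Vv] := calV_neq0.
have [v0|v0] := leP 0 v.
  have /andP[_] := Vv k; apply: le_lt_trans; rewrite lerDl mulr_ge0//.
  rewrite betaE; apply: mulr_ge0; first exact: ltW.
  apply: sumr_ge0 => j _.
  by rewrite invr_ge0 mulr_ge0// ltW.
exfalso; have [M MP] := sum_alpha_bound.
have alphaM j : alpha j <= M.
  apply: le_trans (MP j.+1); rewrite big_ord_recr/= lerDr sumr_ge0// => i _.
  exact: ltW.
have M0 : 0 < M by apply: lt_le_trans (alpha_gt0' 0) (alphaM 0%N).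
have bound n : \sum_(j < n) (a j)^-1 <= M / - v.
  have /andP[+ _] := Vv n; rewrite betaE mulrCA -[X in X + _]mulr1 -mulrDr pmulr_rgt0// => L.
  have L' : \sum_(j < n.+1) (a j * alpha j)^-1 < (- v)^-1.
    by rewrite -[(- v)^-1]mul1r ltr_pdivlMr ?oppr_gt0//; lra.
  rewrite mulrC -ler_pdivrMr//; apply/ltW; apply: le_lt_trans L'.
  rewrite mulr_suml big_ord_recr/= ler_wpDr//.
    by rewrite invr_ge0 mulr_ge0// ltW.
  have aal j : 0 < a j * alpha j by apply: mulr_gt0.
  have aM j : 0 < a j * M by apply: mulr_gt0.
  by apply: ler_sum => j _; rewrite -invfM lef_pV2 ?posrE// ler_pM2l.
have : (\sum_(0 <= k <oo) ((a k)^-1)%:E <= (M / - v)%:E)%E.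
  apply: lime_le.
    by apply: is_cvg_ereal_nneg_natsum => j _; rewrite lee_fin invr_ge0 ltW.
  by apply: nearW => j; rewrite big_mkord sumEFin lee_fin.
by rewrite sum_inv_a.
Qed.

(** The probability that the first [n] gaps are empty, under the limit law. *)
Definition hole_free n : R := \prod_(k < n) (1 - alpha k.+1).

Lemma hole_free_gt0 n : 0 < hole_free n.
Proof. by apply: prodr_gt0 => k _; rewrite subr_gt0 alpha_lt1. Qed.

Lemma hole_free_noninc : {homo hole_free : n m / (n <= m)%N >-> m <= n}.
Proof.
apply: homo_leq => [n|y x z xy yz|n]; [exact: lexx|exact: le_trans yz xy|].
rewrite /hole_free big_ord_recr/= ler_piMr ?(ltW (hole_free_gt0 n))//.
by rewrite lerBlDr lerDl ltW.
Qed.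

Lemma hole_free_cvg : cvgn hole_free.
Proof.
apply: nonincreasing_is_cvgn hole_free_noninc _.
by exists 0 => _ [n _ <-]; apply/ltW/hole_free_gt0.
Qed.

Lemma alpha_tail : exists K, forall n, \sum_(K <= k < n) alpha k.+1 <= 1 / 2.
Proof.
have [M MP] := sum_alpha_bound.
pose A := [set \sum_(0 <= k < n) alpha k.+1 | n in [set: nat]].
have MP' n : \sum_(0 <= k < n) alpha k.+1 <= M.
  apply: le_trans (MP n.+1); rewrite big_ord_recl/= big_mkord lerDr.
  exact: ltW.
have Asup : has_sup A.
  by split; [exists (\sum_(0 <= k < 0) alpha k.+1); exists 0%N|exists M => _ [n _ <-]].
have [_ [K _ <-] KA] := sup_adherent (eps := 1 / 2) ltac:(lra) Asup.
exists K => n; have [nK|Kn] := leqP n K; first by rewrite big_geq//; lra.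
have : \sum_(0 <= k < n) alpha k.+1 <= sup A by apply: (ub_le_sup Asup.2); exists n.
by rewrite (big_cat_nat (n := K))//=; [lra|exact: ltnW].
Qed.

(** From some [K] on the [alpha k.+1] sum to at most 1/2, and a product of factors
    [1 - alpha k.+1] is at least 1 minus the sum of the [alpha k.+1]. *)
Lemma lim_hole_free_gt0 : 0 < limn hole_free.
Proof.
have [K KP] := alpha_tail.
have prod_ge n : 1 - \sum_(K <= k < n) alpha k.+1 <= \prod_(K <= k < n) (1 - alpha k.+1).
  elim: n => [|n IH]; first by rewrite !big_geq// subr0.
  have [nK|Kn] := leqP n.+1 K; first by rewrite !big_geq// subr0.
  rewrite !big_nat_recr//=.
  have s0 : 0 <= \sum_(K <= k < n) alpha k.+1 by apply: sumr_ge0 => k _; exact: ltW.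
  have := ler_wpM2r (_ : 0 <= 1 - alpha n.+1) IH.
  move=> /(_ ltac:(by rewrite subr_ge0 ltW// alpha_lt1)); apply: le_trans.
  have := mulr_ge0 s0 (ltW (alpha_gt0' n.+1)); lra.
apply: (@lt_le_trans _ _ (hole_free K * (1 / 2))).
  by rewrite mulr_gt0 ?hole_free_gt0//; lra.
apply: limr_ge; first exact: hole_free_cvg.
exists K => // n /= Kn.
rewrite {2}/hole_free -(big_mkord xpredT (fun k => 1 - alpha k.+1)) (big_cat_nat (n := K))//=.
rewrite big_mkord; apply: ler_wpM2l; first exact/ltW/hole_free_gt0.
by have := KP n; have := prod_ge n; lra.
Qed.

Lemma esum_geometric (z : R) : 0 <= z < 1 ->
  (\esum_(j in [set: nat]) (z ^+ j)%:E = ((1 - z)^-1)%:E)%E.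
Proof.
move=> /andP[z0 z1]; rewrite -nneseries_esumT; last by move=> j; rewrite lee_fin exprn_ge0.
apply: cvg_lim => //.
have := @cvg_geometric_series R 1 z; rewrite ger0_norm// => /(_ z1).
rewrite div1r => cv; apply: cvg_EFin; first by apply: nearW => n; rewrite sumEFin.
apply: cvg_trans cv; apply: near_eq_cvg; apply: nearW => n /=.
by rewrite sumEFin /series/=; apply: eq_bigr => i _; rewrite mul1r.
Qed.

Definition anchored_packed n : set configF := anchored `&` packed_from^~ n.

(** The gaps are independent geometric variables under the weight: a configuration
    in [anchored_packed n.+1] is one in [anchored_packed n] together with the
    number [j] of holes in the gap [n]. *)
Lemma esum_anchored_packed n :
  (\esum_(x in anchored_packed n) (weight x)%:E = ((hole_free n)^-1)%:E)%E.
Proof.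
have w0 x : (0 <= (weight x)%:E)%E by rewrite lee_fin ltW// weight_gt0.
elim: n => [|n IH].
  rewrite (_ : anchored_packed 0 = [set config_of (fun=> 0%N) 0]).
    rewrite esum_set1// /hole_free big_ord0 invr1.
    by rewrite (weightE a b (@packed_config_of _ _)) big_ord0.
  apply/seteqP; split => [x [Ax x0]|_ ->].
    apply: anchored_inj => //; first exact: anchored_config_of.
    by apply/funext => k; rewrite gap_config_of x0.
  by split; [exact: anchored_config_of|exact: packed_config_of].
pose ext x j k := if k == n then j else gap x k.
rewrite (@reindex_esum R (configF * nat)%type configF (anchored_packed n `*`` (fun=> setT))
  _ (fun z => config_of (ext z.1 z.2) n.+1)); last first.
  split.
  - by move=> z _; split; [exact: anchored_config_of|exact: packed_config_of].
  - move=> [x j] [x' j'] /[!inE] -[/= [Ax xn] _] [/= [Ax' xn'] _] E.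
    have gE k := congr1 (gap ^~ k) E.
    have jE : j = j' by have := gE n; rewrite !gap_config_of ltnSn /ext eqxx.
    congr (_, _) => //; apply: anchored_inj => //; apply/funext => k.
    have [kn|nk] := ltnP k n; last by rewrite xn// xn'.
    by have := gE k; rewrite !gap_config_of leqW// /ext ltn_eqF.
  - move=> y [Ay yn]; exists (config_of (gap y) n, gap y n).
      by split=> //=; split; [exact: anchored_config_of|exact: packed_config_of].
    apply: anchored_inj => //; first exact: anchored_config_of.
    apply/funext => k; rewrite gap_config_of /ext/=.
    case: (ltngtP k n) => [kn|nk|->]; last by rewrite ltnSn.
      by rewrite ltnS ltnW// gap_config_of kn.
    by rewrite ltnS leqNgt nk/= yn.
rewrite -(esum_esum (a := fun x j => (weight (config_of (ext x j) n.+1))%:E)); last by [].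
under eq_esum => x [Ax xn].
  under eq_esum => j _.
    rewrite (weightE a b (@packed_config_of _ _)) big_ord_recr/= gap_config_of ltnSn /ext eqxx.
    rewrite (eq_bigr (fun k : 'I_n => alpha k.+1 ^+ gap x k)); last first.
      move=> k _; rewrite gap_config_of leqW// ifN//.
      by rewrite neq_ltn ltn_ord.
    rewrite -weightE// EFinM.
    over.
  rewrite esumZl; [|by rewrite ltW// weight_gt0|by move=> j _; rewrite lee_fin exprn_ge0// ltW].
  rewrite esum_geometric; last by rewrite (ltW (alpha_gt0' _)) alpha_lt1.
  rewrite muleC.
  over.
rewrite esumZl ?IH//.
  by rewrite -EFinM /hole_free big_ord_recr/= invfM mulrC.
by rewrite invr_ge0 subr_ge0 ltW// alpha_lt1.
Qed.

Lemma esum_weight : (\esum_(x in anchored) (weight x)%:E = ((limn hole_free)^-1)%:E)%E.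
Proof.
have w0 x : (0 <= (weight x)%:E)%E by rewrite lee_fin ltW// weight_gt0.
have W0 := lim_hole_free_gt0.
apply/eqP; rewrite eq_le; apply/andP; split.
  apply: ge_ereal_sup => _ [X [finX XA] <-].
  rewrite fsbig_finite//=; set r : seq configF := fset_set X.
  have rX x : x \in r -> X x by rewrite /r in_fset_set// inE.
  pose n := (\max_(x <- r) front x)%N.
  apply: (@le_trans _ _ (\esum_(x in anchored_packed n) (weight x)%:E)%E).
    apply: le_sum_esum => //; first exact: fset_uniq.
    move=> x xr; split; first exact/XA/rX.
    by apply: packed_from_le (@front_packed x); exact: leq_bigmax_seq.
  rewrite esum_anchored_packed lee_fin lef_pV2 ?posrE ?hole_free_gt0//.
  exact: nonincreasing_cvgn_ge hole_free_noninc hole_free_cvg _.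
have le n : (((hole_free n)^-1)%:E <= \esum_(x in anchored) (weight x)%:E)%E.
  by rewrite -esum_anchored_packed; apply: le_esum_set => // x [].
have cv : ((hole_free n)^-1)%:E @[n --> \oo] --> ((limn hole_free)^-1)%:E.
  apply: cvg_EFin; first exact: nearW.
  apply: cvgV; first by rewrite gt_eqF.
  exact: hole_free_cvg.
by rewrite -(cvg_lim _ cv)//; apply: lime_le; [apply/cvg_ex; eexists; exact: cv|exact: nearW].
Qed.

End PartitionFunction.

(** * Initial law and limit *)

Lemma measure_esum_fibers (R : realType) (d : measure_display) (T : measurableType d)
    (P : {measure set T -> \bar R}) (S : choiceType) (X : T -> S) (A : set T) :
  countable [set: S] ->
  (forall x, measurable (A `&` [set w | X w = x])) ->
  (P A = \esum_(x in [set: S]) P (A `&` [set w | X w = x]))%E.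
Proof.
move=> /countable_injP[f finj] mAX.
have fx x y : f x = f y -> x = y by apply: finj; rewrite inE.
pose F n := A `&` [set w | f (X w) = n].
have Ff x : F (f x) = A `&` [set w | X w = x].
  by apply/seteqP; split => w [Aw /= E]; split => //=; [exact: fx|rewrite E].
have Fout n : ~ (exists x, f x = n) -> F n = set0.
  by move=> nx; apply/seteqP; split => // w [_ /= E]; apply: nx; exists (X w).
have mF n : measurable (F n).
  have [[x <-]|nx] := pselect (exists x, f x = n); first by rewrite Ff.
  by rewrite Fout.
have AF : A = \bigcup_(n in [set: nat]) F n.
  by apply/seteqP; split => [w Aw|w [n _ []]//]; exists (f (X w)).
rewrite {1}AF measure_bigcup//; last by move=> i j _ _ [w [[_ /= <-] [_ /= <-]]].
rewrite nneseries_esum// (_ : [set x | _] = setT); last first.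
  by apply/seteqP; split => // n _; rewrite /= inE.
rewrite (esumID (range f))// setTI [X in (_ + X)%E]esum1 ?adde0; last first.
  by move=> n [_ nx]; rewrite Fout ?measure0// => -[x E]; apply: nx; exists x.
rewrite esum_image; last by move=> x y _ _; exact: fx.
by apply: eq_esum => x _; rewrite Ff.
Qed.

Section InitialLaw.
Variables (R : realType) (a b : nat -> R).
Hypotheses (a_gt0 : forall k, 0 < a k) (b_gt0 : forall k, 0 < b k).
Hypothesis sum_inv_a : (\sum_(0 <= k <oo) ((a k)^-1)%:E = +oo)%E.
Variables (d : measure_display) (T : measurableType d) (P : probability T R).
Variable (X : R -> T -> configF).
Hypothesis X_meas : forall (t : R) x, 0 <= t -> measurable [set w | X t w = x].
Variable p : R -> configF -> configF -> R.
Hypothesis tf : transition_function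
  (fun x y : configF => jump_rate a b (val x) (val y)) p.
Hypothesis X_markov : forall (n : nat) (t : nat -> R) (x : nat -> configF),
  0 <= t 0%N -> (forall i, t i <= t i.+1) ->
  (P [set w | forall i, (i <= n.+1)%N -> X (t i) w = x i] =
   P [set w | forall i, (i <= n)%N -> X (t i) w = x i] *
   (p (t n.+1 - t n) (x n) (x n.+1))%:E)%E.
Implicit Types (x y : configF) (t : R).

Definition law x : R := fine (P [set w | X 0 w = x]).

Lemma lawE x : (law x)%:E = P [set w | X 0 w = x].
Proof. by rewrite fineK// fin_num_measure//; exact: X_meas. Qed.

Lemma law_ge0 x : 0 <= law x.
Proof. by rewrite /law fine_ge0. Qed.

Lemma law_mass : (\esum_(x in [set: configF]) (law x)%:E = 1)%E.
Proof.
rewrite -(probability_setT P) (measure_esum_fibers P countable_configF (X := X 0)).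
  by apply: eq_esum => x _; rewrite setTI lawE.
by move=> x; rewrite setTI; exact: X_meas.
Qed.

Lemma two_times t x y : 0 <= t ->
  (P ([set w | X 0 w = x] `&` [set w | X t w = y]) = (law x * p t x y)%:E)%E.
Proof.
move=> t0.
(* the finite-dimensional law at the two times 0 and [t] *)
have := @X_markov 0%N (fun i => if i is 0%N then 0 else t) (fun i => if i is 0%N then x else y)
  (lexx _).
move=> /(_ _)/wrap[]; first by case.
rewrite subr0 EFinM lawE => E.
rewrite (_ : _ `&` _ = [set w | forall i, (i <= 1)%N ->
  X (if i is 0%N then 0 else t) w = if i is 0%N then x else y]).
  rewrite E; congr (P _ * _)%E; apply/seteqP; split => [w /(_ 0%N (leqnn _))//|w /= Xw [|i]//].
by apply/seteqP; split => [w [/= X0 Xt] [|[|i]]//|w Xw]; split; [exact: (Xw 0%N)|exact: (Xw 1%N)].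
Qed.

Lemma same_gaps_prob t y : 0 <= t ->
  (P [set w | gap (X t w) = gap y] =
   \esum_(x in [set: configF]) (law x * lumped p t x y)%:E)%E.
Proof.
move=> t0.
have mA x z : measurable ([set w | X 0 w = x] `&` [set w | X t w = z]).
  by apply: measurableI; exact: X_meas.
have slice z : [set w | gap (X t w) = gap y] `&` [set w | X t w = z] =
    if `[< same_gaps y z >] then [set w | X t w = z] else set0.
  case: asboolP => yz; apply/seteqP; split => // w.
  - by move=> /= E; split => //=; rewrite E.
  - by move=> [/= gE E]; apply: yz; rewrite /same_gaps/= -E.
have slice2 x z : ([set w | gap (X t w) = gap y] `&` [set w | X 0 w = x]) `&`
    [set w | X t w = z] = if `[< same_gaps y z >] then
      [set w | X 0 w = x] `&` [set w | X t w = z] else set0.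
  by rewrite setIAC slice; case: ifP => _; rewrite ?set0I// setIC.
have mgap : measurable [set w | gap (X t w) = gap y].
  have /countable_injP[f finj] := countable_configF.
  have fx u v : f u = f v -> u = v by apply: finj; rewrite inE.
  rewrite (_ : [set w | _] =
    \bigcup_n ([set w | gap (X t w) = gap y] `&` [set w | f (X t w) = n])).
    apply: bigcup_measurable => n _.
    have [[z <-]|nz] := pselect (exists z, f z = n).
      rewrite (_ : [set w | f (X t w) = f z] = [set w | X t w = z]).
        by rewrite slice; case: ifP => // _; exact: X_meas.
      by apply/seteqP; split => w /= E; [exact: fx|rewrite E].
    rewrite (_ : [set w | f (X t w) = n] = set0) ?setI0//.
    by apply/seteqP; split => // w /= E; apply: nz; exists (X t w).
  by apply/seteqP; split => [w gw|w [n _ []]//]; exists (f (X t w)).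
rewrite (measure_esum_fibers P countable_configF (X := X 0)); last first.
  by move=> x; apply: measurableI => //; exact: X_meas.
apply: eq_esum => x _.
rewrite (measure_esum_fibers P countable_configF (X := X t)); last first.
  by move=> z; rewrite slice2; case: ifP.
rewrite EFinM (hitE tf)// -esumZl ?law_ge0//; last first.
  by move=> z _; rewrite lee_fin (tf_ge0 tf).
rewrite [RHS]esum_mkcond; apply: eq_esum => z _; rewrite slice2.
have -> : (z \in same_gaps y) = `[< same_gaps y z >] by apply/idP/asboolP; rewrite inE.
case: ifP => _; last exact: measure0.
by rewrite -EFinM; exact: two_times.
Qed.

(** The kernel [lumped t x y] converges for each initial state [x]; dominated
    convergence with respect to the initial law averages over [x]. *)
Lemma same_gaps_prob_cvg (Z : R) y :
  (\esum_(x in anchored) (weight a b x)%:E = Z%:E)%E -> anchored y ->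
  P [set w | gap (X t w) = gap y] @[t --> +oo] --> (weight a b y / Z)%:E.
Proof.
move=> wZ Ay; have pos := nbhs_pinfty_ge (num_real (0 : R)).
have lc x : lumped p t x y @[t --> +oo] --> weight a b y / Z.
  exact: (lumped_cvg a_gt0 b_gt0 sum_inv_a tf).
set c := weight a b y / Z in lc *.
have wy : 0 < weight a b y by exact: weight_gt0.
have wyZ : weight a b y <= Z.
  rewrite -lee_fin -wZ; apply: (@ge_esum_term R configF _ (fun x => (weight a b x)%:E)) => // x _.
  by rewrite lee_fin ltW// weight_gt0.
have Z0 : 0 < Z by exact: lt_le_trans wyZ.
have c01 : 0 <= c <= 1.
  by rewrite divr_ge0 ?(ltW wy) ?(ltW Z0)//= ler_pdivrMr// mul1r.
have law0 x : [set: configF] x -> 0 <= law x by move=> _; exact: law_ge0.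
have law_fin : (\esum_(x in [set: configF]) (law x)%:E < +oo)%E by rewrite law_mass ltry.
have l01 t x : 0 <= t -> 0 <= lumped p t x y <= 1.
  by move=> t0; rewrite (hit_ge0 tf)// (hit_le1 tf).
have f01 : \forall t \near +oo, forall x, [set: configF] x -> 0 <= `|lumped p t x y - c| <= 1.
  by apply: filterS pos => t t0 x _; rewrite normr_ge0/= ler_norml; have := l01 t x t0; lra.
have f0 x : [set: configF] x -> `|lumped p t x y - c| @[t --> +oo] --> (0 : R).
  move=> _; apply/norm_cvg0P; have := cvgB (lc x) (cvg_cst c).
  by rewrite subrr; exact.
have /fine_cvgP[fin /cvgrPdist_lt cv] : (\esum_(x in [set: configF])
    (law x * `|lumped p t x y - c|)%:E)%E @[t --> +oo] --> (0%:E : \bar R).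
  exact: esum_cvg0.
have prob_fin t : 0 <= t -> P [set w | gap (X t w) = gap y] \is a fin_num.
  move=> t0; rewrite same_gaps_prob// ge0_fin_numE; last first.
    by apply: esum_ge0 => x _; rewrite lee_fin mulr_ge0 ?law_ge0// (hit_ge0 tf).
  apply: le_lt_trans law_fin; apply: le_esum => x _; rewrite lee_fin ler_piMr ?law_ge0//.
  by case/andP: (l01 t x t0).
apply: cvg_EFin; first by apply: filterS pos => t; exact: prob_fin.
apply/cvgrPdist_lt => e e0; apply: filterS3 pos fin (cv e e0) => t t0 fint.
rewrite sub0r normrN /=; set dl := fine (esum _ _).
have dlE : (dl%:E = \esum_(x in [set: configF]) (law x * `|lumped p t x y - c|)%:E)%E.
  by rewrite /dl fineK.
set r := fine _.
have rE : (r%:E = \esum_(x in [set: configF]) (law x * lumped p t x y)%:E)%E.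
  by rewrite /r fineK ?prob_fin// same_gaps_prob.
have cE : (c%:E = \esum_(x in [set: configF]) (law x * c)%:E)%E.
  under eq_esum do rewrite mulrC EFinM; rewrite esumZl ?law_mass ?mule1//.
  by case/andP: c01.
have dist : `|r - c| <= dl.
  apply: (esum_dist law0 _ _ (esym rE) (esym cE) (esym dlE)) => x _.
    by case/andP: (l01 t x t0).
  by case/andP: c01.
move=> dle; rewrite distrC; apply: le_lt_trans dist _.
exact: le_lt_trans (ler_norm _) dle.
Qed.

End InitialLaw.

Theorem theorem1p12 (R : realType) (a b : nat -> R)
  (a_gt0 : forall k, 0 < a k) (b_gt0 : forall k, 0 < b k)
  (sum_inv_a : (\sum_(0 <= k <oo) ((a k)^-1)%:E = +oo)%E)
  (calV_neq0 : calV a b !=set0)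
  (sum_alpha : (\sum_(0 <= k <oo) (alpha a b k)%:E < +oo)%E)
  (d : measure_display) (T : measurableType d) (P : probability T R)
  (X : R -> T -> configF)
  (X_chain : markov_chain
     (fun x y : configF => jump_rate a b (val x) (val y)) P X)
  (m : nat -> nat) :
  let partial_prod (n : nat) : R :=
    \prod_(k < n) ((1 - alpha a b k.+1) * alpha a b k.+1 ^+ m k) in
  cvgn partial_prod /\
  P [set w | forall k, holes (val (X t w)) k = (m k)%:Z] @[t --> +oo] -->
    (limn partial_prod)%:E.
Proof.
move=> partial_prod.
have al0 k : 0 < alpha a b k by exact: alpha_gt0.
have al1 k : alpha a b k.+1 < 1 by exact: alpha_lt1.
have alm k : 0 <= alpha a b k.+1 ^+ m k <= 1.
  by rewrite exprn_ge0 ?(ltW (al0 _))//= exprn_ile1// ltW.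
have fac k : 0 <= (1 - alpha a b k.+1) * alpha a b k.+1 ^+ m k <= alpha a b k.+1 ^+ m k.
  have /andP[h0 h1] := alm k; have := al0 k.+1; have := al1 k => ? ?.
  by apply/andP; split; [apply: mulr_ge0 => //; lra|rewrite ler_piMl//; lra].
have pp0 n : 0 <= partial_prod n.
  by apply: prodr_ge0 => k _; case/andP: (fac k).
have pp_step n : partial_prod n.+1 <= partial_prod n * alpha a b n.+1 ^+ m n.
  rewrite /partial_prod big_ord_recr/=; apply: ler_wpM2l; first exact: pp0.
  by case/andP: (fac n).
have pp_ni : {homo partial_prod : n k / (n <= k)%N >-> k <= n}.
  apply: homo_leq => [n|y x z xy yz|n]; [exact: lexx|exact: le_trans yz xy|].
  apply: le_trans (pp_step n) _; rewrite ler_piMr//; by case/andP: (alm n).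
have pp_cvg : cvgn partial_prod.
  by apply: nonincreasing_is_cvgn pp_ni _; exists 0 => _ [n _ <-].
split => //.
have [X_meas [p tf X_markov]] := X_chain.
have [[n0 mn0]|m_inf] := pselect (exists n, forall k, (n <= k)%N -> m k = 0%N).
  pose y := config_of m n0.
  have gy : gap y = m.
    by apply/funext => k; rewrite gap_config_of; case: ltnP => // /mn0.
  have wZ := esum_weight a_gt0 b_gt0 sum_inv_a calV_neq0 sum_alpha.
  have := same_gaps_prob_cvg a_gt0 b_gt0 sum_inv_a X_meas tf X_markov wZ
    (anchored_config_of m n0).
  rewrite -/y gy invrK.
  have -> : limn partial_prod = weight a b y * limn (hole_free a b).
    apply: cvg_lim => //.
    apply: (@cvg_trans _ ((weight a b y * hole_free a b n) @[n --> \oo])); last first.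
      apply: cvgM; first exact: cvg_cst.
      exact: (hole_free_cvg a_gt0 b_gt0 sum_inv_a calV_neq0 sum_alpha).
    apply: near_eq_cvg; exists n0 => // n /= nn0.
    rewrite (@weightE _ a b n); last first.
      by move=> k nk; rewrite gy mn0// (leq_trans nn0).
    rewrite /partial_prod big_split/= mulrC; congr (_ * _).
    by apply: eq_bigr => k _; rewrite gy.
  apply: cvg_trans; apply: near_eq_cvg; apply: nearW => t; congr (P _).
  apply/seteqP; split => w /= E.
    by move=> k; rewrite holesE E.
  by apply/funext => k; apply/eqP; rewrite -eqz_nat -holesE E.
(* Infinitely many factors have [m k > 0], hence a factor at most [alpha k.+1],
   which tends to 0; and no configuration has infinitely many holes. *)
have -> : limn partial_prod = 0.
  apply: cvg_lim => //; apply/cvgrPdist_lt => e e0.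
  have [M MP] := sum_alpha_bound a_gt0 b_gt0 sum_alpha.
  have [K KP] : exists K, forall k, (K <= k)%N -> alpha a b k < e.
    have /cvg_series_cvg_0/cvgrPdist_lt/(_ e e0)[K _ KP] : cvgn (series (alpha a b)).
      apply: nondecreasing_is_cvgn; last first.
        by exists M => _ [n _ <-]; rewrite /series/= big_mkord.
      apply/nondecreasing_seqP => n; rewrite !seriesEnat/= big_nat_recr//= lerDl.
      exact: ltW.
    exists K => k Kk; have := KP k Kk; rewrite sub0r normrN ger0_norm//; exact: ltW.
  have [k [Kk mk]] : exists k, (K <= k)%N /\ (0 < m k)%N.
    apply: contrapT => /forallNP nk; apply: m_inf; exists K => k Kk.
    by apply/eqP; rewrite -leqn0 leqNgt; apply/negP => mk; apply: (nk k).
  exists k.+1 => // n /= kn; rewrite sub0r normrN ger0_norm//.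
  apply: le_lt_trans (pp_ni _ _ kn) _; apply: le_lt_trans (pp_step k) _.
  have pp1 : partial_prod k <= 1.
    by apply: le_trans (pp_ni 0%N k (leq0n k)) _; rewrite /partial_prod big_ord0.
  apply: (@le_lt_trans _ _ (alpha a b k.+1 ^+ m k)).
    by rewrite ler_piMl//; case/andP: (alm k).
  apply: le_lt_trans (KP k.+1 (leqW Kk)).
  by rewrite -[leRHS]expr1; apply: ler_wiXn2l => //; exact: ltW.
rewrite (_ : (fun t => P _) = cst 0%E); first exact: cvg_cst.
apply/funext => t; rewrite (_ : [set w | _] = set0) ?measure0//.
apply/seteqP; split => // w /= E; apply: m_inf; exists (front (X t w)) => k nk.
by apply/eqP; rewrite -eqz_nat -E holesE front_packed.
Qed.
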